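(* Let $\mathbf Z$ be an $N\times n$ random matrix whose entries are independent sub-Gaussian random variables with mean zero and variance $1$, and sub-Gaussian norm bounded by a constant. Let $M_n=\frac1N\mathbf Z^\top\mathbf Z$, and let $G_n$ be the adjacency matrix of a graph on $n$ vertices. Suppose $N\ge n$. Let $\theta\in\mathbb R$ be a constant and $A_n(i,j)=\theta M_n(i,j)G_n(i,j)$. Then for $r\in[2,\infty]$, $$\|A_n\|_r=O_P\Big(\frac{n^{1-1/r}}{\sqrt N}\Big)\qquad(n\to\infty).$$ Moreover, $\|A_n\|_r=O_P\Big(\frac{n^{1/r}}{\sqrt N}\Big)$ for $r\in[1,2)$.
   Context: $\|A_n\|_r$ is the $\ell_r\to\ell_r$ operator norm; for $r=\infty$, $n^{1/r}$ is read as $1$. Graphs are simple, so $G_n$ is symmetric with $\{0,1\}$ entries and $G_n(i,i)=0$; $G_n$ is deterministic (or independent of $\mathbf Z$ and conditioned upon). $N=N(n)$. $\theta$ and the bound on the sub-Gaussian norms do not depend on $n$. *)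

(* Defs.v *)
From HB Require Import structures.
From mathcomp Require Import all_boot all_order all_algebra.
From mathcomp Require Import all_classical all_reals all_analysis.
Set Implicit Arguments.
Unset Strict Implicit.
Unset Printing Implicit Defensive.
Import Order.TTheory GRing.Theory Num.Theory.
Import numFieldNormedType.Exports.

Local Open Scope classical_set_scope.
Local Open Scope ring_scope.

(* Only meant for 1 <= r <= +oo; the value at -oo is junk. *)
Definition lr_norm (R : realType) (n : nat) (r : \bar R) (x : 'cV[R]_n) : R :=
  match r with
  | EFin p => (\sum_(i < n) `|x i 0| `^ p) `^ p^-1
  | +oo%E => \big[Num.max/0]_(i < n) `|x i 0|
  | -oo%E => 0
  end.

Definition lr_opnorm (R : realType) (m n : nat) (r : \bar R)
    (A : 'M[R]_(m, n)) : R :=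
  sup [set lr_norm r (A *m x) | x in [set x : 'cV[R]_n | lr_norm r x <= 1]].

Definition recip (R : realType) (r : \bar R) : R :=
  if r is EFin p then p^-1 else 0.

(* Orlicz psi_2 norm; it is +oo when X is not sub-Gaussian. *)
Definition psi2_norm (d : measure_display) (T : measurableType d)
    (R : realType) (P : probability T R) (X : T -> R) : \bar R :=
  ereal_inf [set t%:E | t in
    [set t : R | 0 < t /\
       ('E_P[(fun w => expR (X w ^+ 2 / t ^+ 2))] <= 2%:E)%E]].

Definition mutually_independent (d : measure_display) (T : measurableType d)
    (R : realType) (P : probability T R) (I : finType)
    (X : I -> {RV P >-> R}) : Prop :=
  forall (J : {set I}) (B : I -> set R),
    (forall i, measurable (B i)) ->
    P (\bigcap_(i in [set i | i \in J]) (X i @^-1` B i)) =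
    (\prod_(i in J) P (X i @^-1` B i))%E.

(* X n = O_P(b n); each X n may live on its own probability space. *)
Definition bigO_P (R : realType) (d : nat -> measure_display)
    (T : forall n, measurableType (d n)) (P : forall n, probability (T n) R)
    (X : forall n, T n -> R) (b : nat -> R) : Prop :=
  forall eps : R, 0 < eps -> exists C : R,
    \forall n \near \oo,
      (P n [set w | (C * b n < `|X n w|)%R] <= eps%:E)%E.

Definition adjacency_mx (R : realType) (n : nat) (e : rel 'I_n) : 'M[R]_n :=
  \matrix_(i, j) (e i j)%:R.

Definition sample_mx (R : realType) (T : Type) (N n : nat)
    (Z : 'I_N -> 'I_n -> T -> R) (w : T) : 'M[R]_(N, n) :=
  \matrix_(k, i) Z k i w.

Definition gram_mx (R : realType) (N n : nat) (Z : 'M[R]_(N, n)) : 'M[R]_n :=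
  N%:R^-1 *: (Z^T *m Z).

Definition masked_mx (R : realType) (n : nat) (theta : R) (M G : 'M[R]_n) :
    'M[R]_n :=
  \matrix_(i, j) (theta * M i j * G i j).

(* Main.v *)
Require Import Defs.
From HB Require Import structures.
From mathcomp Require Import all_boot all_order all_algebra.
From mathcomp Require Import all_classical all_reals all_analysis.
From mathcomp Require Import measurable_realfun ring lra.
Set Implicit Arguments.
Unset Strict Implicit.
Unset Printing Implicit Defensive.
Import Order.TTheory GRing.Theory Num.Theory.
Import numFieldNormedType.Exports.
Local Open Scope classical_set_scope.
Local Open Scope ring_scope.

(**
Only the l2 operator norm matters: on R^n the l_r norm and the l_2 norm differ
by a factor n^|1/r - 1/2|, and both rates are n^|1/r - 1/2| sqrt(n/N).

For unit vectors x, y the bilinear form y^T (M o G) x is 1/N times the sum over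
the rows Z_k of the quadratic chaos Q_k = sum_(i <> j) G_ij y_i x_j Z_ki Z_kj,
whose coefficients have Frobenius norm at most 1.  Averaging over all splittings
of the indices into S and ~: S decouples Q_k; conditionally on the coordinates in
S it is a linear form in the remaining ones, with subgaussian variance proxy
sum_j x_j^2 W_j^2 where each W_j is subgaussian, so that
E exp (lam Q_k) <= exp (c^2 lam^2) for c lam <= 1.  Rows being independent, with
lam = sqrt (n/N) / c <= 1/c (this is where n <= N enters) Chernoff's bound gives
y^T (M o G) x < D sqrt (n/N) outside an event of probability exp (n - n D / c).
This beats the 2^(36 n) pairs of points of a 1/4-net of the unit ball, made of
lattice points, whose number is bounded by the generating function of 2^(- |k|).
*)

(** * Independent blocks of random variables *)

Section independence.
Context (d : measure_display) (T : measurableType d) (R : realType)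
  (P : probability T R) (I : finType) (X : I -> {RV P >-> R}).

(** The pi-system of finite-dimensional events of the block [J]; the sigma-algebra it generates
    holds the events that depend on this block alone. *)
Definition cylinder (J : {set I}) : set (set T) :=
  [set E | exists2 B : I -> set R, (forall i, measurable (B i)) &
     E = \bigcap_(i in [set i | i \in J]) (X i @^-1` B i)].

Notation sigma J := (g_sigma_algebraType (cylinder J)).

Lemma cylinder_measurable J : cylinder J `<=` measurable.
Proof.
move=> _ [B mB ->]; apply: fin_bigcap_measurable => // i _.
exact: measurable_funPTI.
Qed.

Lemma sigma_measurable J : <<s cylinder J >> `<=` @measurable _ T.
Proof.
apply: smallest_sub; first exact: sigma_algebra_measurable.
exact: cylinder_measurable.
Qed.

Lemma cylinder_setI J : setI_closed (cylinder J).
Proof.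
move=> _ _ [B mB ->] [C mC ->]; exists (fun i => B i `&` C i).
  by move=> i; exact: measurableI.
by rewrite -bigcapI.
Qed.

Lemma cylinderT J : cylinder J setT.
Proof.
exists (fun=> setT) => //; apply/seteqP; split => // x _ i _ //.
Qed.

Lemma measurable_sigma_coord (J : {set I}) (i : I) : i \in J ->
  measurable_fun setT (X i : sigma J -> R).
Proof.
move=> iJ _ B mB; rewrite setTI; apply: sub_sigma_algebra.
exists (fun j => if j == i then B else setT).
  by move=> j; case: ifP.
apply/seteqP; split => [x /= Bx j /= _|x /= /(_ i iJ)]; last by rewrite eqxx.
by case: eqP => [->|].
Qed.

Hypothesis indepX : mutually_independent X.

Lemma cylinder_indep (J K : {set I}) E F : [disjoint J & K]%bool ->
  cylinder J E -> cylinder K F -> P (E `&` F) = (P E * P F)%E.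
Proof.
move=> JK [B mB ->] [C mC ->].
(* Gluing the two families of Borel sets turns the intersection into one cylinder over [J :|: K], to
   which the independence hypothesis applies. *)
pose D i := if i \in J then B i else C i.
have mD i : measurable (D i) by rewrite /D; case: ifP.
have -> : \bigcap_(i in [set i | i \in J]) (X i @^-1` B i) `&`
    \bigcap_(i in [set i | i \in K]) (X i @^-1` C i) =
    \bigcap_(i in [set i | i \in J :|: K]) (X i @^-1` D i).
  apply/seteqP; split=> [x [BJ CK] i /=|x DJK]; rewrite /D.
    rewrite inE; case: ifPn => [iJ _|iJ /= iK]; first exact: BJ.
    exact: CK.
  split=> i /= iJ; have := DJK i; rewrite /= /D inE iJ ?orbT /=; first exact.
  by rewrite (disjointFl JK iJ); exact.
rewrite !indepX// (eq_bigl [predU J & K]); last by move=> i; rewrite !inE.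
rewrite bigU//=; congr (_ * _)%E; apply: eq_bigr => i iJ; rewrite /D ?iJ//.
by rewrite (disjointFl JK iJ).
Qed.

(* The finite measures [E |-> P (E `&` F)] and [E |-> P E * P F] agree on the
   pi-system [G]. *)
Lemma g_sigma_algebra_indep (G : set (set T)) (F : set T) : G `<=` measurable ->
  setI_closed G -> G setT -> measurable F ->
  (forall E, G E -> P (E `&` F) = (P E * P F)%E) ->
  forall E, <<s G >> E -> P (E `&` F) = (P E * P F)%E.
Proof.
move=> Gm GI GT mF GF E sGE.
have PF0 : (0 <= fine (P F)) by apply: fine_ge0; exact: measure_ge0.
have scE A : mscale (NngNum PF0) P A = (P A * P F)%E.
  by rewrite /mscale/= fineK 1?muleC// fin_num_measure.
rewrite -(scE E) -[LHS]/(mrestr P mF E).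
apply: (g_sigma_algebra_measure_unique G Gm (fun=> setT)) => //.
- exact: bigcup_const.
- by move=> A /GF GA; rewrite /= scE.
- move=> _ /=; rewrite /mrestr setTI; apply: le_lt_trans (ltry 1).
  exact: probability_le1.
Qed.

(** Two pi-lambda arguments: the first, with [F] fixed, reduces to a cylinder [E]; the second treats
    [F] with that cylinder fixed. *)
Lemma sigma_indep (J K : {set I}) E F : [disjoint J & K]%bool ->
  <<s cylinder J >> E -> <<s cylinder K >> F -> P (E `&` F) = (P E * P F)%E.
Proof.
move=> JK sE sF.
apply: (@g_sigma_algebra_indep (cylinder J)) => //.
- exact: cylinder_measurable.
- exact: cylinder_setI.
- exact: cylinderT.
- exact: (@sigma_measurable K).
move=> {sE} {}E cE; rewrite setIC muleC.
have mE := cylinder_measurable cE.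
move: sF; apply: g_sigma_algebra_indep => //.
- exact: cylinder_measurable.
- exact: cylinder_setI.
- exact: cylinderT.
- by move=> A cA; rewrite setIC muleC; exact: (cylinder_indep JK).
Qed.

(** The identity into a coarser measurable space: its law is [P] restricted to the sigma-algebra of
    [J], and the law of [diag] below is the joint law of two blocks. *)
Let idm J (w : T) : sigma J := w.
Let midm J : measurable_fun setT (@idm J).
Proof. by move=> _ B mB; rewrite setTI; exact: (@sigma_measurable J). Qed.
HB.instance Definition _ J := isMeasurableFun.Build _ _ _ _ (@idm J) (@midm J).
Let diag J K (w : T) : sigma J * sigma K := (w, w).
Let mdiag J K : measurable_fun setT (@diag J K).
Proof. by apply: measurable_fun_pair; exact: midm. Qed.
HB.instance Definition _ J K :=
  isMeasurableFun.Build _ _ _ _ (@diag J K) (@mdiag J K).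

(** By independence the law of [diag J K] agrees on rectangles with the product of the two
    restrictions of [P], hence equals it; Tonelli's theorem then gives the iterated integral. *)
Lemma integral_decouple (J K : {set I}) (h : sigma J * sigma K -> \bar R) :
  [disjoint J & K]%bool ->
  measurable_fun setT h -> (forall z, 0 <= h z)%E ->
  (\int[P]_w h (w, w) = \int[P]_w \int[P]_w' h (w, w'))%E.
Proof.
move=> JK mh h0.
transitivity (\int[distribution P (@diag J K)]_z h z)%E.
  by rewrite ge0_integral_distribution.
transitivity (\int[distribution P (@idm J) \x distribution P (@idm K)]_z h z)%E.
  apply: eq_measure_integral => A mA _; apply/esym.
  apply: product_measure_unique => //= E F mE mF.
  exact: (sigma_indep JK mE mF).
rewrite fubini_tonelli1// ge0_integral_distribution//.
- apply: eq_integral => w _ /=; rewrite /fubini_F ge0_integral_distribution//.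
  by move=> ?; exact: (measurableT_comp mh).
- exact: measurable_fun_fubini_tonelli_F.
- by move=> y; apply: integral_ge0 => x _.
Qed.

End independence.

(** * Products of functions of disjoint blocks *)

Section products.
Context (d : measure_display) (T : measurableType d) (R : realType)
  (P : probability T R) (I : finType) (X : I -> {RV P >-> R}).

Notation sigma J := (g_sigma_algebraType (cylinder X J)).

Lemma measurable_sigma_subset (J K : {set I}) (f : T -> R) : J \subset K ->
  measurable_fun setT (f : sigma J -> R) -> measurable_fun setT (f : sigma K -> R).
Proof.
move=> /fintype.subsetP JK mf _ B mB; have := mf measurableT B mB.
suff sJK : cylinder X J `<=` cylinder X K.
  exact: (sub_smallest2r (@smallest_sigma_algebra _ setT (cylinder X K)) sJK).
move=> _ [C mC ->].
exists (fun i => if i \in J then C i else setT); first by move=> i; case: ifP.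
apply/seteqP; split=> x h i /= iK.
  by case: ifPn => // iJ; exact: h.
by have := h i (JK i iK); rewrite /= iK.
Qed.

Hypothesis indepX : mutually_independent X.

(** Induction on [s]: the block of the head is disjoint from the union [JK] of the blocks of the
    tail, so the two factors decouple. *)
Lemma integral_prod_indep (K : eqType) (s : seq K) (J : K -> {set I})
    (f : K -> T -> R) :
  uniq s -> (forall k l, k != l -> [disjoint J k & J l]%bool) ->
  (forall k, measurable_fun setT (f k : sigma (J k) -> R)) ->
  (forall k w, 0 <= f k w) ->
  (\int[P]_w (\prod_(k <- s) f k w)%:E = \prod_(k <- s) \int[P]_w (f k w)%:E)%E.
Proof.
move=> us disJ mf f0; elim: s us => [_|k s IH /= /andP[ks us]].
  rewrite big_nil; under eq_integral do rewrite big_nil.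
  by rewrite integral_cst//= probability_setT mule1.
pose JK := \big[@finset.setU I/finset.set0]_(l <- s) J l.
have sJK l : l \in s -> J l \subset JK.
  by move=> ls; rewrite /JK (big_rem l)//=; exact: finset.subsetUl.
have mprod : measurable_fun setT
    ((fun w => \prod_(l <- s) f l w) : sigma JK -> R).
  apply: measurable_prod => l ls.
  exact: (measurable_sigma_subset (sJK _ ls) (mf l)).
have mprodT : measurable_fun setT (fun w : T => \prod_(l <- s) f l w).
  by move=> _ B mB; apply: (@sigma_measurable _ _ _ _ _ X JK); exact: mprod.
have mfkT : measurable_fun setT (f k : T -> R).
  by move=> _ B mB; apply: (@sigma_measurable _ _ _ _ _ X (J k)); exact: mf.
have prod0 w : 0 <= \prod_(l <- s) f l w by apply: prodr_ge0.
rewrite big_cons -IH//.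
under eq_integral do rewrite big_cons.
have dis : [disjoint J k & JK]%bool.
  rewrite disjoint_subset; apply/fintype.subsetP => i iJk; rewrite inE/= /JK.
  apply/negP => iU; have [l ls iJl] : exists2 l, l \in s & i \in J l.
    move: iU; elim: {ks us IH sJK mprod mprodT prod0 JK} s => [|l s IH].
      by rewrite big_nil inE.
    rewrite big_cons inE => /orP[iJl|/IH[m ms iJm]].
      by exists l => //; rewrite mem_head.
    by exists m => //; rewrite inE ms orbT.
  have kl : k != l by apply: contraNneq ks => ->.
  by rewrite (disjointFr (disJ _ _ kl) iJk) in iJl.
rewrite (@integral_decouple _ _ _ _ _ _ indepX (J k) JK
  (fun z => (f k z.1 * \prod_(l <- s) f l z.2)%:E))//=.
- transitivity (\int[P]_w (\int[P]_w' (\prod_(l <- s) f l w')%:E * (f k w)%:E))%E.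
    apply: eq_integral => w _; rewrite muleC -ge0_integralZl//.
    - by apply/measurable_EFinP.
    - by move=> w' _; rewrite lee_fin.
    - by rewrite lee_fin.
  rewrite ge0_integralZl//.
  - by rewrite muleC.
  - by apply/measurable_EFinP.
  - by move=> w _; rewrite lee_fin.
  - by apply: integral_ge0 => w _; rewrite lee_fin.
- apply/measurable_EFinP; apply: measurable_funM.
    exact: (measurableT_comp (mf k) measurable_fst).
  exact: (measurableT_comp mprod measurable_snd).
- by move=> z; rewrite lee_fin mulr_ge0.
Qed.

End products.

(** * Exponential inequalities *)

Section real_inequalities.
Context (R : realType).
Implicit Types x t u v : R.

(** Since [1 - u <= expR (- u)], one has [expR u <= 1 + u * expR u]; it remains to bound
    [u * (expR u - 1)] for each sign of [u]. *)
Lemma expR_le_taylor1 u : expR u <= 1 + u + u ^+ 2 * expR `|u|.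
Proof.
have e0 := expR_gt0 u.
have h : expR u - 1 <= u * expR u.
  have := expR_ge1Dx (- u); rewrite expRN => h.
  have : (1 - u) * expR u <= 1 by rewrite -ler_pdivlMr// div1r.
  by rewrite mulrBl mul1r; lra.
suff : u * (expR u - 1) <= u ^+ 2 * expR `|u| by lra.
have [u0|u0] := leP 0 u.
  by rewrite ger0_norm// expr2 -mulrA ler_wpM2l.
have e1 : 1 <= expR `|u| by rewrite -expR0 ler_expR.
apply: (@le_trans _ _ (u ^+ 2)); last by rewrite ler_peMr// sqr_ge0.
have := expR_ge1Dx u; nra.
Qed.

(** [(1 + 3 * x / 8) ^+ 2] dominates [x], hence so does [expR (3 * x / 4)]. *)
Lemma expR_quarter x : 0 <= x -> x * expR (x / 4) <= expR x.
Proof.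
move=> x0; have -> : expR x = expR (3 * x / 8) ^+ 2 * expR (x / 4).
  by rewrite expr2 -!expRD; congr expR; lra.
rewrite ler_wpM2r ?expR_ge0//.
have h := expR_ge1Dx (3 * x / 8).
apply: (@le_trans _ _ ((1 + 3 * x / 8) ^+ 2)); first nra.
by rewrite ler_pXn2r ?nnegrE ?expR_ge0//; lra.
Qed.

(** The linear term is kept apart because it integrates to zero for a centered variable. In the
    remainder, [|t * x|] is the geometric mean of [a] and [s], hence at most [a + s / 4], and
    [expR_quarter] absorbs the factor [s]. *)
Lemma expR_le_subgaussian (kappa t x : R) : 0 < kappa ->
  expR (t * x) <= 1 + t * x + (t * kappa) ^+ 2 * expR ((t * kappa) ^+ 2) *
     expR ((x / kappa) ^+ 2).
Proof.
move=> k0; apply: (le_trans (expR_le_taylor1 _)); rewrite lerD2l.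
set a := (t * kappa) ^+ 2; set s := (x / kappa) ^+ 2.
have a0 : 0 <= a by exact: sqr_ge0.
have s0 : 0 <= s by exact: sqr_ge0.
have asE : (t * x) ^+ 2 = a * s.
  by rewrite /a /s -exprMn; congr (_ ^+ 2); field; rewrite gt_eqF.
have h : `|t * x| <= a + s / 4.
  rewrite -ler_sqr ?nnegrE//; last lra.
  rewrite real_normK ?num_real// asE.
  by have := sqr_ge0 (a - s / 4); nra.
rewrite asE; clearbody a s; rewrite -!mulrA ler_wpM2l//.
apply: (@le_trans _ _ (s * (expR a * expR (s / 4)))).
  by rewrite ler_wpM2l// -expRD ler_expR.
by rewrite mulrCA ler_wpM2l ?expR_ge0// expR_quarter.
Qed.

Lemma expR_mul3 x : 0 <= x -> 1 + 2 * (x * expR x) <= expR (3 * x).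
Proof.
move=> x0; have -> : expR (3 * x) = expR (2 * x) * expR x.
  by rewrite -expRD; congr expR; lra.
have h1 := expR_ge1Dx (2 * x).
have h2 : 1 <= expR x by rewrite -expR0 ler_expR.
apply: (@le_trans _ _ ((1 + 2 * x) * expR x)); first nra.
by rewrite ler_wpM2r// expR_ge0.
Qed.

(** Jensen's inequality through the tangent line at the weighted mean [m]; the missing mass [1 - W]
    is placed at the point 0. *)
Lemma expR_jensen (J : Type) (s : seq J) (p : pred J) (w u : J -> R) :
  (forall i, 0 <= w i) -> \sum_(i <- s | p i) w i <= 1 ->
  expR (\sum_(i <- s | p i) w i * u i) <=
  (1 - \sum_(i <- s | p i) w i) + \sum_(i <- s | p i) w i * expR (u i).
Proof.
move=> w0; set m := \sum_(i <- s | p i) _ * _.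
set W := \sum_(i <- s | p i) w i => w1.
have tangent v : expR m * (1 + v - m) <= expR v.
  have -> : expR v = expR m * expR (v - m) by rewrite -expRD; congr expR; lra.
  by rewrite ler_wpM2l ?expR_ge0// -addrA expR_ge1Dx.
apply: (@le_trans _ _ ((1 - W) * (expR m * (1 + 0 - m)) +
  \sum_(i <- s | p i) w i * (expR m * (1 + u i - m)))).
  have -> : \sum_(i <- s | p i) w i * (expR m * (1 + u i - m)) =
      expR m * ((1 - m) * W + m).
    rewrite mulrDr /W /m mulr_sumr !mulr_sumr -big_split/=.
    by apply: eq_bigr => i _; ring.
  by rewrite [leRHS](_ : _ = expR m)//; ring.
apply: lerD.
  by rewrite -[leRHS]mulr1 ler_wpM2l ?subr_ge0// -[leRHS]expR0 tangent.
by apply: ler_sum => i _; rewrite ler_wpM2l.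
Qed.

End real_inequalities.

(** * Subgaussian variables *)

Section subgaussian.
Context (d : measure_display) (T : measurableType d) (R : realType)
  (P : probability T R).

(** The infimum need not be attained; [|K| + 1] lies strictly above it, so some admissible [t] is
    smaller, and the integrand decreases in [t]. *)
Lemma psi2_norm_expR (X : T -> R) (K : R) : measurable_fun setT X ->
  (psi2_norm P X <= K%:E)%E ->
  (\int[P]_w (expR ((X w / (`|K| + 1)) ^+ 2))%:E <= 2%:E)%E.
Proof.
move=> mX XK.
have : (psi2_norm P X < (`|K| + 1)%:E)%E.
  apply: le_lt_trans XK _; rewrite lte_fin.
  by rewrite (le_lt_trans (ler_norm K))// ltrDl.
move=> /ereal_inf_lt[_ [t [t0 Et] <-]]; rewrite lte_fin => tK.
move: Et; rewrite unlock => Et; apply: le_trans Et.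
apply: ge0_le_integral => //.
- apply/measurable_EFinP; apply: measurableT_comp => //.
  by apply: measurable_funX; exact: measurable_funM.
- apply/measurable_EFinP; apply: measurableT_comp => //.
  by apply: measurable_funM => //; exact: measurable_funX.
- have K0 : 0 < `|K| + 1 by exact: lt_trans tK.
  move=> w _; rewrite lee_fin ler_expR exprMn exprVn ler_wpM2l ?sqr_ge0//.
  rewrite lef_pV2 ?posrE; [|exact: exprn_gt0|exact: exprn_gt0].
  by rewrite ler_sqr ?nnegrE ltW.
Qed.

Lemma subgaussian_integrable (X : T -> R) (kappa : R) : 0 < kappa ->
  measurable_fun setT X ->
  (\int[P]_w (expR ((X w / kappa) ^+ 2))%:E <= 2%:E)%E ->
  P.-integrable setT (EFin \o (fun w => expR ((X w / kappa) ^+ 2))) /\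
  P.-integrable setT (EFin \o X).
Proof.
move=> k0 mX EX.
have iE : P.-integrable setT (EFin \o (fun w => expR ((X w / kappa) ^+ 2))).
  apply/integrableP; split.
    apply/measurable_EFinP; apply: measurableT_comp => //.
    by apply: measurable_funX; exact: measurable_funM.
  apply: le_lt_trans (ltry 2); apply: le_trans EX.
  by under eq_integral do rewrite /= ger0_norm ?expR_ge0//.
split=> //; have ikE := integrableZl measurableT kappa iE.
apply: le_integrable ikE => //; first exact/measurable_EFinP.
move=> w _ /=; rewrite lee_fin [leRHS]ger0_norm ?mulr_ge0 ?expR_ge0 ?(ltW k0)//.
rewrite -ler_pdivrMl//.
set u := X w / kappa.
have -> : kappa^-1 * `|X w| = `|u| by rewrite normrM normfV (gtr0_norm k0) mulrC.
have := normr_ge0 u; have := expR_ge1Dx (u ^+ 2); have := sqr_ge0 (`|u| - 1).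
by rewrite sqrrB1 real_normK ?num_real//; lra.
Qed.

(** Integrating [expR_le_subgaussian] kills the linear term and leaves [1 + 2 * (a * expR a)], which
    [expR_mul3] bounds by [expR (3 * a)]. *)
Lemma subgaussian_mgf (X : T -> R) (kappa t : R) : 0 < kappa ->
  measurable_fun setT X -> (\int[P]_w (X w)%:E = 0)%E ->
  (\int[P]_w (expR ((X w / kappa) ^+ 2))%:E <= 2%:E)%E ->
  (\int[P]_w (expR (t * X w))%:E <= (expR (3 * (t * kappa) ^+ 2))%:E)%E.
Proof.
move=> k0 mX EX0 EX2; have [iE iX] := subgaussian_integrable k0 mX EX2; set a := (t * kappa) ^+ 2.
have a0 : 0 <= a by exact: sqr_ge0.
have mtX : measurable_fun setT (fun w => expR (t * X w)).
  by apply: measurableT_comp => //; exact: measurable_funM.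
pose g w := 1 + t * X w + a * expR a * expR ((X w / kappa) ^+ 2).
have i1 : P.-integrable setT (EFin \o cst (1 : R)).
  exact: finite_measure_integrable_cst.
have iD : P.-integrable setT (fun w => (1 + t * X w)%:E).
  under eq_fun do rewrite EFinD EFinM.
  by apply: integrableD => //; exact: integrableZl.
have iM : P.-integrable setT
    (fun w => (a * expR a * expR ((X w / kappa) ^+ 2))%:E).
  by under eq_fun do rewrite EFinM; exact: integrableZl.
have ig : P.-integrable setT (EFin \o g).
  have -> : EFin \o g = (fun w => ((1 + t * X w)%:E +
      (a * expR a * expR ((X w / kappa) ^+ 2))%:E)%E).
    by apply/funext => w /=; rewrite /g EFinD.
  exact: integrableD.
have itX : P.-integrable setT (EFin \o (fun w => expR (t * X w))).
  apply: le_integrable ig => //; first exact/measurable_EFinP.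
  move=> w _ /=; rewrite lee_fin ger0_norm ?expR_ge0// (le_trans _ (ler_norm _))//.
  exact: expR_le_subgaussian.
apply: (@le_trans _ _ (\int[P]_w (g w)%:E)%E).
  apply: le_integral => // w _; rewrite lee_fin; exact: expR_le_subgaussian.
rewrite /g; under eq_integral do rewrite EFinD.
rewrite integralD//.
have -> : (\int[P]_w (1 + t * X w)%:E = 1)%E.
  under eq_integral do rewrite EFinD EFinM.
  rewrite integralD//; last exact: integrableZl.
  rewrite integralZl// EX0 mule0 adde0 integral_cst//=.
  by rewrite probability_setT mule1.
under eq_integral do rewrite EFinM.
rewrite integralZl//.
apply: (@le_trans _ _ (1 + (a * expR a)%:E * 2%:E)%E).
  by rewrite leeD2l// lee_wpmul2l// lee_fin mulr_ge0 ?expR_ge0.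
rewrite -EFinM -EFinD lee_fin mulrC; exact: expR_mul3.
Qed.

(** Completing the square turns the integrand into a constant times the normal density of mean
    [theta]. *)
Lemma normal_mgf (theta : R) :
  (\int[lebesgue_measure]_x (normal_pdf 0 1 x * expR (theta * x))%:E =
   (expR (theta ^+ 2 / 2))%:E)%E.
Proof.
transitivity (\int[lebesgue_measure]_x
    ((expR (theta ^+ 2 / 2))%:E * (normal_pdf theta (1 : R) x)%:E))%E.
  apply: eq_integral => x _; rewrite -EFinM; congr EFin.
  rewrite !normal_pdfE// /normal_fun.
  rewrite -mulrA [RHS]mulrCA -!expRD; congr (_ * expR _); by field.
rewrite ge0_integralZl//.
- by rewrite integral_normal_pdf mule1.
- apply/measurable_EFinP; exact: measurable_normal_pdf.
- by move=> x _; rewrite lee_fin normal_pdf_ge0.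
Qed.

(* [expR (theta ^+ 2 * W ^+ 2 / 2)] is the moment generating function of a
   standard Gaussian variable at [theta * W], which linearizes the square. *)
Lemma subgaussian_square (W : T -> R) (kappa : R) : 0 < kappa ->
  measurable_fun setT W ->
  (forall t, \int[P]_w (expR (t * W w))%:E <= (expR (3 * (t * kappa) ^+ 2))%:E)%E ->
  (\int[P]_w (expR (W w ^+ 2 / (32 * kappa ^+ 2)))%:E <= 2%:E)%E.
Proof.
(* The Gaussian is evaluated at [W / (4 * kappa)], whose half square is
   [W ^+ 2 / (32 * kappa ^+ 2)]. *)
move=> k0 mW EW; pose h (z : T * measurableTypeR R) : \bar R :=
  (normal_pdf 0 1 z.2 * expR (W z.1 / (4 * kappa) * z.2))%:E.
have h0 z : (0 <= h z)%E by rewrite lee_fin mulr_ge0 ?expR_ge0 ?normal_pdf_ge0.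
have mh : measurable_fun setT h.
  apply/measurable_EFinP; apply: measurable_funM.
    by apply: measurableT_comp => //; exact: measurable_normal_pdf.
  apply: measurableT_comp => //; apply: measurable_funM => //.
  by apply: measurable_funM => //; exact: measurableT_comp.
have mWsq : measurable_fun setT (fun w => (expR (W w ^+ 2 / (32 * kappa ^+ 2)))%:E).
  apply/measurable_EFinP; apply: measurableT_comp => //.
  by apply: measurable_funM => //; exact: measurable_funX.
have -> : (\int[P]_w (expR (W w ^+ 2 / (32 * kappa ^+ 2)))%:E =
    \int[P]_w \int[lebesgue_measure]_x h (w, x))%E.
  apply: eq_integral => w _; rewrite /h /= (normal_mgf (W w / (4 * kappa))).
  congr (expR _)%:E.
  by field; rewrite gt_eqF.
rewrite (fubini_tonelli h)//.
(* After the exchange of integrals, the moment bound at [x / (4 * kappa)] leaves the exponent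
   [3 x^2 / 16 - x^2 / 2 <= - x^2 / 8], that of a normal density of deviation 2; the factor 2 makes
   up for its lower peak. *)
apply: (@le_trans _ _
    (\int[lebesgue_measure]_x (2%:E * (normal_pdf 0 2 x)%:E))%E); last first.
  rewrite ge0_integralZl//.
  - by rewrite integral_normal_pdf mule1.
  - apply/measurable_EFinP; exact: measurable_normal_pdf.
  - by move=> x _; rewrite lee_fin normal_pdf_ge0.
apply: ge0_le_integral => //.
- by move=> x _; apply: integral_ge0.
- exact: measurable_fun_fubini_tonelli_G.
- by apply: measurable_funeM; apply/measurable_EFinP; exact: measurable_normal_pdf.
move=> x _; rewrite /h/=.
under eq_integral do rewrite EFinM.
rewrite ge0_integralZl//; last 2 first.
- apply/measurable_EFinP; apply: measurableT_comp => //.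
  by apply: measurable_funM => //; exact: measurable_funM.
- by rewrite lee_fin normal_pdf_ge0.
under eq_integral.
  move=> w _.
  rewrite (_ : W w / (4 * kappa) * x = x / (4 * kappa) * W w); last first.
    by field; rewrite gt_eqF.
  over.
apply: (@le_trans _ _ ((normal_pdf 0 1 x)%:E *
    (expR (3 * (x / (4 * kappa) * kappa) ^+ 2))%:E)%E).
  by rewrite lee_wpmul2l// lee_fin normal_pdf_ge0.
rewrite -!EFinM lee_fin !normal_pdfE// /normal_fun /normal_peak.
have -> : Num.sqrt (2 ^+ 2 * pi *+ 2) = 2 * Num.sqrt (1 ^+ 2 * pi *+ 2) :> R.
  rewrite -mulrnAr sqrtrM ?sqr_ge0// sqrtr_sqr ger0_norm//.
  by rewrite expr1n mul1r.
have p0 : 0 < Num.sqrt (1 ^+ 2 * pi *+ 2) :> R.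
  by rewrite sqrtr_gt0 expr1n mul1r pmulrn_lgt0// pi_gt0.
set p := Num.sqrt _ in p0 *.
have -> (y : R) : 2 * ((2 * p)^-1 * y) = p^-1 * y by field; rewrite gt_eqF.
rewrite -[leLHS]mulrA ler_wpM2l ?invr_ge0 ?(ltW p0)//.
rewrite -expRD ler_expR.
have -> : x / (4 * kappa) * kappa = x / 4 by field; rewrite gt_eqF.
by have := sqr_ge0 x; rewrite !subr0; lra.
Qed.


End subgaussian.

(** * Decoupled quadratic chaos *)

(** Removing [i] maps the separating sets bijectively onto the subsets of the complement of
    [{i, j}]. *)
Lemma card_separating (I : finType) (i j : I) : i != j ->
  (#|[set S : {set I} | (i \in S) && (j \notin S)]%SET| * 4 = 2 ^ #|I|)%N.
Proof.
move=> ij; pose D := (~: [set i; j])%SET.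
have -> : [set S : {set I} | (i \in S) && (j \notin S)]%SET =
    [set (i |: S)%SET | S in powerset D]%SET.
  apply/setP => S; rewrite inE; apply/andP/imsetP => [[iS jS]|[U]].
    exists (S :\ i)%SET; last by rewrite finset.setD1K.
    rewrite powersetE; apply/fintype.subsetP => k; rewrite !inE negb_or.
    by move=> /andP[-> kS] /=; apply: contraNneq jS => <-.
  rewrite powersetE => /fintype.subsetP UD ->; rewrite !inE eqxx; split=> //.
  rewrite negb_or eq_sym ij; apply/negP => /UD.
  by rewrite !inE eqxx orbT.
rewrite card_in_imset.
  rewrite card_powerset -[4%N]/(2 ^ 2)%N -expnD; congr (_ ^ _)%N.
  by rewrite -(cardsC [set i; j]%SET) cards2 ij addnC.
move=> U V; rewrite !powersetE => /fintype.subsetP UD /fintype.subsetP VD.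
move=> /(congr1 (fun A => A :\ i)%SET); rewrite !setU1K//.
  by apply/negP => /VD; rewrite !inE eqxx.
by apply/negP => /UD; rewrite !inE eqxx.
Qed.

(* A pair [i != j] is separated, in this order, by a quarter of the subsets. *)
Lemma decoupling_sum (R : realType) (I : finType) (B : I -> I -> R) :
  (forall i, B i i = 0) ->
  \sum_i \sum_j B i j = \sum_(S : {set I}) (2 ^+ #|I|)^-1 *
    (4 * \sum_(j in ~: S) \sum_(i in S) B i j).
Proof.
move=> B0; rewrite -!mulr_sumr.
have -> : \sum_(S : {set I}) \sum_(j in ~: S) \sum_(i in S) B i j =
    \sum_(S : {set I}) \sum_i \sum_j
       (if (i \in S) && (j \notin S) then B i j else 0).
  apply: eq_bigr => S _; rewrite [RHS]exchange_big/= big_mkcond/=.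
  apply: eq_bigr => j _; rewrite inE big_mkcond/=.
  case: ifPn => jS; last by rewrite big1// => i _; rewrite andbF.
  by apply: eq_bigr => i _; rewrite andbT.
rewrite [in RHS]exchange_big mulrA mulr_sumr; apply: eq_bigr => i _ /=.
rewrite [in RHS]exchange_big mulr_sumr; apply: eq_bigr => j _ /=.
rewrite -big_mkcond/= sumr_const -[B i j *+ _]mulr_natr.
have [<-|ij] := eqVneq i j; first by rewrite B0 mul0r mulr0.
have /(congr1 (fun k => k%:R : R)) := card_separating ij.
rewrite cardsE natrM natrX => <-; field.
rewrite pnatr_eq0 -lt0n; apply/card_gt0P; exists [set i]%SET.
by rewrite unfold_in/= !inE eqxx eq_sym.
Qed.

Lemma lee_prode (R : realType) (I : Type) (s : seq I) (f g : I -> \bar R) :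
  (forall i, 0 <= f i)%E -> (forall i, f i <= g i)%E ->
  (\prod_(i <- s) f i <= \prod_(i <- s) g i)%E.
Proof.
move=> f0 fg; elim: s => [|i s IH]; first by rewrite !big_nil.
by rewrite !big_cons lee_pmul// prode_ge0.
Qed.

Lemma ler_sum_sqr_sub (R : realType) (I : finType) (p : pred I) (c : I -> R) :
  \sum_(i | p i) c i ^+ 2 <= \sum_i c i ^+ 2.
Proof.
by rewrite [leRHS](bigID p)/= lerDl; apply: sumr_ge0 => i _; exact: sqr_ge0.
Qed.

Section subfamily.
Context (d : measure_display) (T : measurableType d) (R : realType)
  (P : probability T R) (I J : finType) (X : I -> {RV P >-> R}) (f : J -> I).

Lemma mutually_independent_comp : injective f -> mutually_independent X ->
  mutually_independent (fun j => X (f j)).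
Proof.
move=> finj indX S B mB.
(* The sets [B] are transported along [f], with no constraint off its image. *)
pose C i := if [pick j | f j == i] is Some j then B j else setT.
have Cf j : C (f j) = B j.
  rewrite /C; case: pickP => [k /eqP/finj->//|/(_ j)]; by rewrite eqxx.
have mC i : measurable (C i) by rewrite /C; case: pickP.
have := indX (f @: S)%SET C mC.
rewrite big_imset/=; last by move=> ? ? _ _; exact: finj.
under eq_bigr do rewrite Cf.
move=> <-; congr (P _); apply/seteqP; split=> x h i /=.
  by move=> /imsetP[j jS ->]; rewrite Cf; exact: h.
by move=> iS; have := h (f i) (imset_f _ iS); rewrite /= Cf.
Qed.

End subfamily.

Section chaos.
Context (d : measure_display) (T : measurableType d) (R : realType)
  (P : probability T R) (I : finType) (Z : I -> {RV P >-> R}) (kappa : R).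
Hypothesis indepZ : mutually_independent Z.
Hypothesis kappa0 : 0 < kappa.
Hypothesis mgfZ : forall i t,
  (\int[P]_w (expR (t * Z i w))%:E <= (expR (3 * (t * kappa) ^+ 2))%:E)%E.

Notation sigma J := (g_sigma_algebraType (cylinder Z J)).

Lemma linear_mgf (S : {set I}) (c : I -> R) :
  (\int[P]_w (expR (\sum_(i in S) c i * Z i w))%:E <=
   (expR (3 * kappa ^+ 2 * \sum_(i in S) c i ^+ 2))%:E)%E.
Proof.
under eq_integral do rewrite -big_enum/= expR_sum.
rewrite (@integral_prod_indep _ _ _ _ _ _ indepZ I (enum S) (fun i => [set i]%SET)
  (fun i w => expR (c i * Z i w))).
- rewrite -big_enum/= mulr_sumr expR_sum -prodEFin.
  apply: lee_prode => i; first by apply: integral_ge0 => w _; rewrite lee_fin expR_ge0.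
  by rewrite (_ : _ * c i ^+ 2 = 3 * (c i * kappa) ^+ 2); last ring.
- exact: enum_uniq.
- by move=> k l kl; rewrite finset.disjoints1 inE.
- move=> i; apply: measurableT_comp => //; apply: measurable_funM => //.
  by apply: measurable_sigma_coord; rewrite inE.
- by move=> i w; exact: expR_ge0.
Qed.

Lemma measurable_sigma_sum (S : {set I}) (c : I -> R) :
  measurable_fun setT ((fun w => \sum_(i in S) c i * Z i w) : sigma S -> R).
Proof.
have -> : (fun w => \sum_(i in S) c i * Z i w) = fun w => \sum_(i <- enum S)
    (if i \in S then c i * Z i w else 0).
  by apply/funext => w; rewrite big_enum/=; apply: eq_bigr => i ->.
apply: (@measurable_sum _ (sigma S)) => i.
case: (boolP (i \in S)) => iS; last exact: measurable_cst.
by apply: measurable_funM => //; exact: measurable_sigma_coord.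
Qed.

(** Integrating first over the coordinates outside [S] leaves the exponential of a weighted sum of
    squares of the forms [W j]. These are dependent, but Jensen's inequality replaces the product of
    exponentials by an average, which only needs each [W j] separately. *)
Lemma half_chaos_mgf (S : {set I}) (G : I -> I -> R) (x y : I -> R) (lam : R) :
  (forall i j, `|G i j| <= 1) -> \sum_i x i ^+ 2 <= 1 -> \sum_i y i ^+ 2 <= 1 ->
  96 * kappa ^+ 4 * lam ^+ 2 <= 1 ->
  (\int[P]_w (expR (lam * \sum_(j in ~: S) \sum_(i in S)
     G i j * y i * x j * (Z i w * Z j w)))%:E <=
   (expR (96 * kappa ^+ 4 * lam ^+ 2))%:E)%E.
Proof.
move=> G1 x1 y1; set b := 96 * kappa ^+ 4 * lam ^+ 2 => b1.
have b0 : 0 <= b by rewrite /b mulr_ge0 ?sqr_ge0// mulr_ge0// exprn_even_ge0.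
pose W j w := \sum_(i in S) (G i j * y i) * Z i w.
have mWs j : measurable_fun setT (W j : sigma S -> R).
  exact: measurable_sigma_sum.
have mW j : measurable_fun setT (W j).
  by move=> _ B mB; apply: (@sigma_measurable _ _ _ _ _ Z S); exact: mWs.
pose h (z : T * T) := (expR (\sum_(j in ~: S) lam * x j * W j z.1 * Z j z.2))%:E.
have h0 z : (0 <= h z)%E by rewrite lee_fin expR_ge0.
(* Decoupling needs measurability for the two block sigma-algebras; [mh] repeats it on [T * T] for
   the measurability of the inner integral. *)
have mhs : measurable_fun setT (h : sigma S * sigma (~: S)%SET -> \bar R).
  apply/measurable_EFinP; apply: measurableT_comp => //.
  have -> : (fun z : T * T => \sum_(j in ~: S) lam * x j * W j z.1 * Z j z.2) =
      fun z => \sum_(j <- enum (~: S)%SET)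
        (if j \in (~: S)%SET then lam * x j * W j z.1 * Z j z.2 else 0).
    by apply/funext => z; rewrite big_enum/=; apply: eq_bigr => i ->.
  apply: (@measurable_sum _ (sigma S * sigma (~: S)%SET)%type) => j.
  case: (boolP (j \in (~: S)%SET)) => jS; last exact: measurable_cst.
  apply: measurable_funM.
    apply: measurable_funM => //.
    exact: (measurableT_comp (mWs j) measurable_fst).
  have mZ : measurable_fun setT (Z j : sigma (~: S)%SET -> R).
    exact: measurable_sigma_coord.
  exact: (measurableT_comp mZ measurable_snd).
have mh : measurable_fun setT h.
  apply/measurable_EFinP; apply: measurableT_comp => //.
  under eq_fun do rewrite -big_enum/=.
  apply: measurable_sum => j; apply: measurable_funM.
    by apply: measurable_funM => //; exact: measurableT_comp.
  exact: measurableT_comp.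
have -> : (\int[P]_w (expR (lam * \sum_(j in ~: S) \sum_(i in S)
     G i j * y i * x j * (Z i w * Z j w)))%:E = \int[P]_w h (w, w))%E.
  apply: eq_integral => w _; congr (expR _)%:E; rewrite mulr_sumr.
  apply: eq_bigr => j _; rewrite /= /W !mulr_sumr mulr_suml.
  by apply: eq_bigr => i _; ring.
rewrite (integral_decouple indepZ _ mhs)//; last first.
  by rewrite -finset.setI_eq0 finset.setICr.
pose v j w := expR (W j w ^+ 2 / (32 * kappa ^+ 2)).
have mv j : measurable_fun setT (v j).
  apply: measurableT_comp => //.
  by apply: measurable_funM => //; exact: measurable_funX.
(* The weights turn the conditional exponent [3 * kappa ^+ 2 * (lam * x j * W j) ^+ 2] into [u j]
   times the exponent in [v j], as 96 = 3 * 32; the smallness of [lam] keeps their sum below 1. *)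
pose u j := b * x j ^+ 2.
have u1 : \sum_(j in ~: S) u j <= 1.
  rewrite -mulr_sumr; apply: le_trans b1; rewrite ler_piMr//.
  by apply: le_trans x1; exact: ler_sum_sqr_sub.
have u0 j : 0 <= u j by rewrite /u mulr_ge0 ?sqr_ge0.
apply: (@le_trans _ _ (\int[P]_t ((1 - \sum_(j in ~: S) u j)%:E +
    \sum_(j <- enum (~: S)%SET) (u j * v j t)%:E))%E).
  apply: ge0_le_integral => //.
  - by move=> t _; apply: integral_ge0.
  - exact: (measurable_fun_fubini_tonelli_F h).
  - apply: emeasurable_funD => //; apply: emeasurable_sum => j.
    by apply/measurable_EFinP; exact: measurable_funM.
  move=> t _; rewrite /h /=.
  apply: le_trans (linear_mgf (~: S)%SET (fun j => lam * x j * W j t)) _.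
  rewrite sumEFin -EFinD lee_fin big_enum/=.
  apply: le_trans (expR_jensen _ u0 u1); rewrite ler_expR mulr_sumr.
  rewrite le_eqVlt; apply/orP; left; apply/eqP; apply: eq_bigr => j _.
  by rewrite /u /b; field; rewrite gt_eqF.
rewrite ge0_integralD//; first last.
- apply: emeasurable_sum => j.
  by apply/measurable_EFinP; exact: measurable_funM.
- by move=> t _; apply: sume_ge0 => j _; rewrite lee_fin mulr_ge0 ?expR_ge0.
- by move=> t _; rewrite lee_fin subr_ge0.
rewrite integral_cst//= probability_setT mule1 ge0_integral_sum//; last 2 first.
- by move=> j; apply/measurable_EFinP; exact: measurable_funM.
- by move=> j t _; rewrite lee_fin mulr_ge0 ?expR_ge0.
(* Each [v j] has expectation at most 2, because the coefficients [G i j * y i] of [W j] have square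
   sum at most 1. *)
apply: (@le_trans _ _ ((1 - \sum_(j in ~: S) u j)%:E +
    \sum_(j <- enum (~: S)%SET) (2 * u j)%:E)%E).
  rewrite leeD2l//; apply: lee_sum => j _.
  under eq_integral do rewrite (EFinM (u j)).
  rewrite ge0_integralZl//; last 3 first.
  - by apply/measurable_EFinP.
  - by move=> t _; rewrite lee_fin expR_ge0.
  - by rewrite lee_fin.
  rewrite (mulrC 2) (EFinM (u j)) lee_wpmul2l ?lee_fin//.
  apply: subgaussian_square => // t.
  under eq_integral do (rewrite /W mulr_sumr; under eq_bigr do rewrite mulrA).
  apply: le_trans (linear_mgf S (fun i => t * (G i j * y i))) _.
  rewrite lee_fin ler_expR -mulrA ler_pM2l// exprMn [leRHS]mulrC.
  rewrite ler_wpM2l ?sqr_ge0//.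
  under eq_bigr do rewrite exprMn.
  rewrite -mulr_sumr ler_piMr ?sqr_ge0//.
  apply: (@le_trans _ _ (\sum_(i in S) y i ^+ 2)); last first.
    by apply: le_trans y1; exact: ler_sum_sqr_sub.
  apply: ler_sum => i _; rewrite exprMn ler_piMl ?sqr_ge0//.
  by rewrite -real_normK ?num_real// exprn_ile1// normr_ge0.
rewrite sumEFin -EFinD lee_fin big_enum/=.
have -> : \sum_(j in ~: S) 2 * u j = 2 * \sum_(j in ~: S) u j by rewrite mulr_sumr.
set s := \sum_(j in _) _; apply: (@le_trans _ _ (1 + s)); first lra.
apply: le_trans (expR_ge1Dx _); rewrite lerD2l /s /u -mulr_sumr ler_piMr//.
by apply: le_trans x1; exact: ler_sum_sqr_sub.
Qed.

Lemma chaos_mgf (G : I -> I -> R) (x y : I -> R) (lam : R) :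
  (forall i, G i i = 0) -> (forall i j, `|G i j| <= 1) ->
  \sum_i x i ^+ 2 <= 1 -> \sum_i y i ^+ 2 <= 1 ->
  (40 * kappa ^+ 2 * lam) ^+ 2 <= 1 ->
  (\int[P]_w (expR (lam * \sum_i \sum_j G i j * y i * x j * (Z i w * Z j w)))%:E <=
   (expR ((40 * kappa ^+ 2 * lam) ^+ 2))%:E)%E.
Proof.
move=> G0 G1 x1 y1 lam1.
(* Each decoupled half carries the parameter [4 * lam], and 96 * 16 = 1536 is at most 40 ^ 2 =
   1600. *)
have k2 : 96 * kappa ^+ 4 * (4 * lam) ^+ 2 <= (40 * kappa ^+ 2 * lam) ^+ 2.
  have -> : (40 * kappa ^+ 2 * lam) ^+ 2 =
      96 * kappa ^+ 4 * (4 * lam) ^+ 2 + 64 * (kappa ^+ 2 * lam) ^+ 2 by ring.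
  by rewrite lerDl mulr_ge0// sqr_ge0.
pose q S w := \sum_(j in ~: S) \sum_(i in S) G i j * y i * x j * (Z i w * Z j w).
have mq S : measurable_fun setT (q S).
  rewrite /q; under eq_fun do rewrite -big_enum/=.
  apply: measurable_sum => j; under eq_fun do rewrite -big_enum/=.
  by apply: measurable_sum => i; apply: measurable_funM => //; exact: measurable_funM.
pose r : R := (2 ^+ #|I|)^-1.
have r0 : 0 <= r by rewrite invr_ge0 exprn_ge0.
have r1 : \sum_(S : {set I}) r = 1.
  have cI : #|{: {set I}}| = (2 ^ #|I|)%N.
    by rewrite -[LHS]cardsT -powersetT card_powerset cardsT.
  rewrite sumr_const cI.
  by rewrite -mulr_natr natrX mulVf// expf_neq0.
have mQ S : measurable_fun setT (fun w => (r * expR (4 * lam * q S w))%:E).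
  apply/measurable_EFinP; apply: measurable_funM => //.
  by apply: measurableT_comp => //; exact: measurable_funM.
(* The chaos is the uniform average of [4 * q S] over all [S]; Jensen's inequality takes the average
   out of the exponential. *)
have hQ w : expR (lam * \sum_i \sum_j G i j * y i * x j * (Z i w * Z j w)) <=
    \sum_(S : {set I}) r * expR (4 * lam * q S w).
  rewrite (decoupling_sum (B := fun i j => G i j * y i * x j * (Z i w * Z j w))).
    rewrite mulr_sumr.
    rewrite (eq_bigr (fun S => r * (4 * lam * q S w))); last first.
      by move=> S _; rewrite /r /q; ring.
    apply: le_trans (expR_jensen _ (fun=> r0) _) _; first by rewrite r1.
    by rewrite r1 subrr add0r.
  by move=> i; rewrite G0 !mul0r.
apply: (@le_trans _ _ (\int[P]_w \sum_(S : {set I}) (r * expR (4 * lam * q S w))%:E)%E).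
  apply: ge0_le_integral => //.
  - apply/measurable_EFinP; apply: measurableT_comp => //; apply: measurable_funM => //.
    apply: measurable_sum => i; apply: measurable_sum => j.
    by apply: measurable_funM => //; exact: measurable_funM.
  - exact: emeasurable_sum.
  - by move=> w _; rewrite sumEFin lee_fin hQ.
rewrite ge0_integral_sum//; last by move=> S w _; rewrite lee_fin mulr_ge0 ?expR_ge0.
apply: (@le_trans _ _ (\sum_(S : {set I})
    (r * expR ((40 * kappa ^+ 2 * lam) ^+ 2))%:E)%E).
  apply: lee_sum => S _; under eq_integral do rewrite (EFinM r).
  rewrite ge0_integralZl//; last first.
    by apply/measurable_EFinP; apply: measurableT_comp => //; exact: measurable_funM.
  rewrite EFinM lee_wpmul2l//.
  apply: le_trans (half_chaos_mgf S G1 x1 y1 (le_trans k2 lam1)) _.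
  by rewrite lee_fin ler_expR.
by rewrite sumEFin lee_fin -mulr_suml r1 mul1r.
Qed.

End chaos.

(** * Sums over independent rows and Chernoff's bound *)

Section rows.
Context (d : measure_display) (T : measurableType d) (R : realType)
  (P : probability T R) (N n : nat) (Z : 'I_N -> 'I_n -> {RV P >-> R}) (kappa : R).
Hypothesis indepZ : mutually_independent (fun ki : 'I_N * 'I_n => Z ki.1 ki.2).
Hypothesis kappa0 : 0 < kappa.
Hypothesis mgfZ : forall k i t,
  (\int[P]_w (expR (t * Z k i w))%:E <= (expR (3 * (t * kappa) ^+ 2))%:E)%E.
Variables (G : 'I_n -> 'I_n -> R) (x y : 'I_n -> R).
Hypothesis G0 : forall i, G i i = 0.
Hypothesis G1 : forall i j, `|G i j| <= 1.
Hypothesis x1 : \sum_i x i ^+ 2 <= 1.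
Hypothesis y1 : \sum_i y i ^+ 2 <= 1.

Let Q k w := \sum_i \sum_j G i j * y i * x j * (Z k i w * Z k j w).

Let mQ k : measurable_fun setT (Q k).
Proof.
apply: measurable_sum => i; apply: measurable_sum => j.
by apply: measurable_funM => //; exact: measurable_funM.
Qed.

(** The rows are disjoint blocks of the family indexed by pairs, so the exponential factors into [N]
    chaos moments. *)
Lemma sum_chaos_mgf (lam : R) : (40 * kappa ^+ 2 * lam) ^+ 2 <= 1 ->
  (\int[P]_w (expR (lam * \sum_k Q k w))%:E <=
   (expR (N%:R * (40 * kappa ^+ 2 * lam) ^+ 2))%:E)%E.
Proof.
move=> lam1; under eq_integral do rewrite mulr_sumr expR_sum.
pose J (k : 'I_N) : {set 'I_N * 'I_n} := [set ki | ki.1 == k]%SET.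
rewrite (@integral_prod_indep _ _ _ _ _ _ indepZ _ (index_enum 'I_N) J
  (fun k w => expR (lam * Q k w))).
- apply: (@le_trans _ _ (\prod_(k < N) (expR ((40 * kappa ^+ 2 * lam) ^+ 2))%:E)%E).
    apply: lee_prode => k.
      by apply: integral_ge0 => w _; rewrite lee_fin expR_ge0.
    apply: chaos_mgf => //.
    apply: (@mutually_independent_comp _ _ _ _ _ _ _ (fun i => (k, i)) _ indepZ).
    by move=> i j [].
  by rewrite prodEFin lee_fin prodr_const card_ord -expRM_natl.
- exact: index_enum_uniq.
- move=> k l kl; rewrite -finset.setI_eq0; apply/eqP/setP => ki; rewrite !inE.
  by apply/negP => /andP[/eqP -> kl']; rewrite kl' in kl.
- move=> k; have mZ i : measurable_fun setT
      (Z k i : g_sigma_algebraType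
        (cylinder (fun ki : 'I_N * 'I_n => Z ki.1 ki.2) (J k)) -> R).
    by apply: (@measurable_sigma_coord _ _ _ _ _ _ _ (k, i)); rewrite inE.
  apply: measurableT_comp => //; apply: measurable_funM => //.
  apply: measurable_sum => i; apply: measurable_sum => j.
  by apply: measurable_funM => //; exact: measurable_funM.
- by move=> k w; exact: expR_ge0.
Qed.

Lemma sum_chaos_tail (lam tau : R) : 0 < lam -> (40 * kappa ^+ 2 * lam) ^+ 2 <= 1 ->
  (P [set w | (tau <= \sum_k Q k w)%R] <=
   (expR (N%:R * (40 * kappa ^+ 2 * lam) ^+ 2 - lam * tau))%:E)%E.
Proof.
move=> lam0 lam1; have mS : measurable_fun setT (fun w => \sum_k Q k w).
  exact: measurable_sum.
have mE : measurable_fun setT (fun w => (expR (lam * \sum_k Q k w))%:E).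
  by apply/measurable_EFinP; apply: measurableT_comp => //; exact: measurable_funM.
have := @le_integral_abse _ _ _ P setT measurableT _ (expR (lam * tau)) mE (expR_gt0 _).
under eq_integral do rewrite abse_EFin ger0_norm ?expR_ge0//.
have -> : setT `&` [set w | ((expR (lam * tau))%:E <=
    `|(expR (lam * \sum_k Q k w))%:E|)%E] = [set w | tau <= \sum_k Q k w].
  apply/seteqP; split => w /=; rewrite lee_fin ger0_norm ?expR_ge0// ler_expR ler_pM2l//.
  by case.
move=> /le_trans /(_ (sum_chaos_mgf lam1)).
by rewrite muleC -lee_pdivlMr ?expR_gt0// -EFinM -expRN -expRD.
Qed.

End rows.

(** * Comparison of the l_r norms *)

Section lr_norms.
Context (R : realType) (n : nat).
Implicit Types (x : 'cV[R]_n) (p q : R) (r s : \bar R).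

Lemma lr_norm_ge0 r x : 0 <= lr_norm r x.
Proof.
by case: r => [p||]//=; [exact: powR_ge0|exact: bigmax_ge_id].
Qed.

Lemma lr_norm_powR p x : 0 < p ->
  (lr_norm p%:E x) `^ p = \sum_(i < n) `|x i 0| `^ p.
Proof.
move=> p0; rewrite /= -powRrM mulVf ?gt_eqF// powRr1//.
by apply: sumr_ge0 => i _; exact: powR_ge0.
Qed.

Lemma lr_norm_leP p x M : 0 < p -> 0 <= M ->
  (\sum_(i < n) `|x i 0| `^ p <= M `^ p) -> lr_norm p%:E x <= M.
Proof.
move=> p0 M0 h; have -> : M = (M `^ p) `^ p^-1.
  by rewrite -powRrM mulfV ?gt_eqF// powRr1.
rewrite /= ge0_ler_powR ?invr_ge0 ?(ltW p0)// nnegrE ?powR_ge0//.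
by apply: sumr_ge0 => i _; exact: powR_ge0.
Qed.

Lemma lr_norm_coord r x i : (0 < r)%E -> `|x i 0| <= lr_norm r x.
Proof.
case: r => [p||]//=; last by move=> _; exact: (le_bigmax _ (fun i => `|x i 0|)).
rewrite lte_fin => p0; rewrite leNgt; apply/negP => /(gt0_ltr_powR p0).
move=> /(_ _ _); rewrite !nnegrE normr_ge0 powR_ge0 => /(_ isT isT).
rewrite -/(lr_norm p%:E x) lr_norm_powR// (bigD1 i)//= -subr_gt0 opprD addrA subrr.
rewrite add0r oppr_gt0 ltNge; apply/negP; rewrite negbK.
by apply: sumr_ge0 => j _; exact: powR_ge0.
Qed.

(** Split the power [q] as [p + (q - p)] and bound each coordinate by the [p]-norm in the second
    factor. *)
Lemma lr_norm_anti r s x : (0 < r)%E -> (r <= s)%E -> lr_norm s x <= lr_norm r x.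
Proof.
move=> r0; case: s => [q||] rs; last by move: (lt_le_trans r0 rs).
  move: r r0 rs => [p||]//; rewrite lte_fin lee_fin => p0 pq.
  have q0 := lt_le_trans p0 pq.
  apply: lr_norm_leP => //; first exact: lr_norm_ge0.
  have [->|pq'] := eqVneq p q; first by rewrite lr_norm_powR.
  have qp : 0 < q - p by rewrite subr_gt0 lt_neqAle pq' pq.
  have powS a : a `^ q = a `^ p * a `^ (q - p).
    rewrite -powRD; first by congr (_ `^ _); ring.
    by rewrite addrCA subrr addr0 gt_eqF.
  rewrite (powS (lr_norm _ _)) lr_norm_powR// mulr_suml; apply: ler_sum => i _.
  rewrite (powS `|_|) ler_wpM2l ?powR_ge0// ge0_ler_powR ?(ltW qp)//.
    by rewrite nnegrE lr_norm_ge0.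
  exact: lr_norm_coord.
by apply: bigmax_le => [|i _]; [exact: lr_norm_ge0|exact: lr_norm_coord].
Qed.

(** Young's inequality for the product of [a ^ p] with 1, with conjugate exponents [q / p] and
    [1 / (1 - p / q)]. *)
Lemma young_powR p q a : 0 < p -> p <= q -> 0 <= a ->
  a `^ p <= p / q * a `^ q + (1 - p / q).
Proof.
move=> p0 pq a0; have q0 := lt_le_trans p0 pq.
have [->|npq] := eqVneq p q.
  by rewrite divff ?gt_eqF// mul1r subrr addr0.
have pq1 : 0 < 1 - p / q.
  by rewrite subr_gt0 ltr_pdivrMr// mul1r lt_neqAle npq pq.
have := @conjugate_powR _ (a `^ p) 1 (q / p) (1 - p / q)^-1 (powR_ge0 _ _) ler01.
rewrite divr_gt0// invr_gt0 pq1 => /(_ isT isT).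
rewrite !invrK invf_div mulr1 powR1 mul1r => h; apply: le_trans (h _) _; first by lra.
rewrite -powRrM (_ : p * (q / p) = q); last by field; rewrite gt_eqF.
by rewrite (mulrC (p / q)).
Qed.

Lemma lr_norm_power_mean r s x : (0 < n)%N -> (0 < r)%E -> (r <= s)%E ->
  lr_norm r x <= n%:R `^ (recip r - recip s) * lr_norm s x.
Proof.
move=> n0 r0; have n0' : 0 < n%:R :> R by rewrite ltr0n.
case: s => [q||] rs; last by move: (lt_le_trans r0 rs).
  move: r r0 rs => [p||]//; rewrite lte_fin lee_fin => p0 pq.
  have q0 := lt_le_trans p0 pq.
  apply: lr_norm_leP => //; first by rewrite mulr_ge0 ?powR_ge0 ?lr_norm_ge0.
  (* [m] is the power mean of order [q]. After division by it the [q]-th powers sum to [n], and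
     Young's inequality summed over the coordinates bounds the [p]-th powers by [n]; [m = 0] is
     treated apart. *)
  set m := n%:R `^ (- q^-1) * lr_norm q%:E x.
  have -> : n%:R `^ (recip p%:E - recip q%:E) * lr_norm q%:E x = n%:R `^ p^-1 * m.
    rewrite /m mulrA -powRD//; by rewrite (gt_eqF n0') implybT.
  have m0 : 0 <= m by rewrite mulr_ge0 ?powR_ge0 ?lr_norm_ge0.
  rewrite powRM ?powR_ge0// -powRrM mulVf ?gt_eqF// powRr1 ?(ltW n0')//.
  have mq : n%:R * m `^ q = \sum_(i < n) `|x i 0| `^ q.
    rewrite /m powRM ?powR_ge0 ?lr_norm_ge0// lr_norm_powR//.
    rewrite -powRrM mulNr mulVf ?gt_eqF//.
    by rewrite powRN powRr1 ?(ltW n0')// mulrA divff ?mul1r// gt_eqF.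
  have [m00|m00] := eqVneq m 0.
    rewrite m00 powR0 ?gt_eqF// mulr0 big1// => i _.
    move/eqP: m00; rewrite mulf_eq0 powR_eq0 gt_eqF//= => /eqP m00.
    have := lr_norm_coord x i (r := q%:E); rewrite lte_fin => /(_ q0).
    by rewrite [lr_norm _ _]m00 normr_le0 => /eqP ->; rewrite normr0 powR0// gt_eqF.
  have {}m0 : 0 < m by rewrite lt_neqAle eq_sym m00.
  have scale t (i : 'I_n) : `|x i 0| `^ t = m `^ t * (`|x i 0| / m) `^ t.
    by rewrite -powRM ?(ltW m0) ?divr_ge0 ?(ltW m0)// mulrCA divff ?mulr1.
  under eq_bigr do rewrite scale.
  rewrite -mulr_sumr mulrC ler_wpM2r ?powR_ge0//.
  have mq1 : \sum_(i < n) (`|x i 0| / m) `^ q = n%:R.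
    apply: (@mulfI _ (m `^ q)); first by rewrite gt_eqF// powR_gt0.
    by rewrite mulr_sumr [RHS]mulrC mq; apply: eq_bigr => i _; rewrite -scale.
  apply: (@le_trans _ _ (\sum_(i < n)
      (p / q * (`|x i 0| / m) `^ q + (1 - p / q)))).
    by apply: ler_sum => i _; apply: young_powR => //; rewrite divr_ge0 ?(ltW m0).
  rewrite big_split/= -mulr_sumr mq1 sumr_const card_ord -(mulr_natr (1 - p / q)).
  by rewrite -mulrDl addrC subrK mul1r.
move: r r0 rs => [p||]// p0 _; last by rewrite subrr powRr0 mul1r.
rewrite lte_fin in p0; rewrite {2}/recip subr0.
apply: lr_norm_leP => //; first by rewrite mulr_ge0 ?powR_ge0 ?lr_norm_ge0.
rewrite powRM ?powR_ge0 ?lr_norm_ge0// -powRrM mulVf ?gt_eqF// powRr1 ?(ltW n0')//.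
rewrite mulr_natl -[X in _ *+ X]card_ord -sumr_const; apply: ler_sum => i _.
by rewrite ge0_ler_powR ?(ltW p0) ?nnegrE ?lr_norm_ge0//; exact: lr_norm_coord.
Qed.

Lemma lr_norm2_sqr x : lr_norm 2%:E x ^+ 2 = \sum_(i < n) x i 0 ^+ 2.
Proof.
rewrite -powR_mulrn ?lr_norm_ge0// lr_norm_powR//.
by apply: eq_bigr => i _; rewrite powR_mulrn// real_normK ?num_real.
Qed.

End lr_norms.

(** * A lattice net of the unit ball *)

Section lattice_net.
Context (R : realType) (n : nat).
Hypothesis n0 : (0 < n)%N.

Let code := {ffun 'I_n -> bool * 'I_(16 * n).+1}.
Let D : R := 4 * Num.sqrt n%:R.

(* Points of the lattice [(4 sqrt n)^-1 Z^n], encoded by signs and absolute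
   values. *)
Definition net_point (f : code) (i : 'I_n) : R :=
  (-1) ^+ (f i).1 * ((f i).2%:R / D).

(** As [D ^+ 2] is [16 * n], this is membership in the unit ball, stated in integers. *)
Definition lattice_net : {set code} :=
  [set f : code | (\sum_i (f i).2 ^ 2 <= 16 * n)%N]%SET.

Let D0 : 0 < D.
Proof. by rewrite mulr_gt0// sqrtr_gt0 ltr0n. Qed.

Let D2 : D ^+ 2 = (16 * n)%:R.
Proof. by rewrite exprMn sqr_sqrtr// natrM; congr (_ * _); ring. Qed.

Let D2gt0 : 0 < (16 * n)%:R :> R.
Proof. by rewrite -D2 exprn_gt0. Qed.

Let sqr_signM (b : bool) (t : R) : ((-1) ^+ b * t) ^+ 2 = t ^+ 2.
Proof. by rewrite exprMn sqrr_sign mul1r. Qed.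

Lemma net_point_ball f : f \in lattice_net -> \sum_i net_point f i ^+ 2 <= 1.
Proof.
rewrite inE => fn.
under eq_bigr do rewrite sqr_signM expr_div_n D2.
rewrite -mulr_suml ler_pdivrMr// mul1r.
under eq_bigr do rewrite -natrX.
by rewrite -natr_sum ler_nat.
Qed.

(** Rounding towards zero stays in the ball and costs at most [1 / D] per coordinate, so
    [n / (16 * n)] in squared norm. *)
Lemma net_approx (x : 'I_n -> R) : \sum_i x i ^+ 2 <= 1 ->
  exists2 f, f \in lattice_net & \sum_i (x i - net_point f i) ^+ 2 <= 16^-1.
Proof.
move=> x1; pose a i := D * `|x i|.
have a0 i : 0 <= a i by rewrite mulr_ge0// ltW.
pose k i := Num.truncn (a i).
have kP i : (k i)%:R <= a i < (k i).+1%:R by exact: truncn_itv.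
have ksum : (\sum_i k i ^ 2 <= 16 * n)%N.
  rewrite -(ler_nat R) natr_sum.
  apply: (@le_trans _ _ (\sum_i a i ^+ 2)).
    by apply: ler_sum => i _; rewrite natrX ler_sqr ?nnegrE//; case/andP: (kP i).
  under eq_bigr do rewrite /a exprMn D2 real_normK ?num_real//.
  by rewrite -mulr_sumr ler_piMr.
(* An integer is at most its square, so the bound on the sum of squares keeps each entry within the
   range of the code. *)
have k16 i : (k i < (16 * n).+1)%N.
  rewrite ltnS (leq_trans _ ksum)// (bigD1 i)//=.
  rewrite (leq_trans _ (leq_addr _ _))// -mulnn.
  by case: (k i) => // m; exact: leq_pmull.
pose f : code := [ffun i => (x i < 0, Ordinal (k16 i))].
exists f.
  by rewrite inE; under eq_bigr do rewrite ffunE.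
have -> : 16^-1 = \sum_(i < n) (16 * n)%:R^-1 :> R.
  rewrite sumr_const card_ord -(mulr_natr (_^-1)) natrM; field.
  by rewrite pnatr_eq0 -lt0n.
apply: ler_sum => i _.
have -> : x i - net_point f i = (-1) ^+ (x i < 0)%R * ((a i - (k i)%:R) / D).
  rewrite /net_point ffunE/= {1}(realEsign (num_real (x i))) -mulrBr.
  by congr (_ * _); rewrite /a; field; rewrite gt_eqF.
rewrite sqr_signM expr_div_n D2 ler_pdivrMr// mulVf ?gt_eqF//.
have /andP[k1 k2] := kP i.
by rewrite expr_le1// ?subr_ge0// lerBlDl natr1 ltW.
Qed.

(** On the net the absolute values sum to at most [16 * n], so each point counts at most
    [2 ^ (16 n)] times the product of its weights [u]. Summed over all codes the product factors,
    each coordinate giving at most 4: two signs times a geometric sum below 2. *)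
Lemma card_lattice_net : (#|lattice_net| <= 2 ^ (18 * n))%N.
Proof.
pose u (p : bool * 'I_(16 * n).+1) : R := 2^-1 ^+ p.2.
have u0 p : 0 <= u p by rewrite exprn_ge0// invr_ge0.
have usum : \sum_p u p <= 4.
  rewrite -(pair_big xpredT xpredT (fun (b : bool) (k : 'I_(16 * n).+1) => 2^-1 ^+ k))/=.
  rewrite big_bool/= -mulr2n.
  have geo m : \sum_(k < m) (2^-1 : R) ^+ k <= 2.
    have -> : \sum_(k < m) (2^-1 : R) ^+ k = 2 - 2 * 2^-1 ^+ m.
      elim: m => [|m IH]; first by rewrite big_ord0 expr0; ring.
      by rewrite big_ord_recr/= IH exprS; field.
    by rewrite lerBlDr lerDl mulr_ge0// exprn_ge0// invr_ge0.
  by have := geo (16 * n).+1; lra.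
rewrite -(ler_nat R).
apply: (@le_trans _ _ (\sum_(f in lattice_net) 2 ^+ (16 * n) * \prod_i u (f i))).
  rewrite -sum1_card natr_sum; apply: ler_sum => f; rewrite inE => fn.
  rewrite /u prodrXr exprVn ler_pdivlMr ?exprn_gt0// mul1r ler_weXn2l ?ler1n//.
  rewrite (leq_trans _ fn)// leq_sum// => i _; rewrite -mulnn.
  by case: (nat_of_ord _) => // m; exact: leq_pmull.
apply: (@le_trans _ _ (\sum_(f : code) 2 ^+ (16 * n) * \prod_i u (f i))).
  rewrite [leRHS](bigID (mem lattice_net))/= lerDl; apply: sumr_ge0 => f _.
  by rewrite mulr_ge0 ?exprn_ge0// prodr_ge0.
rewrite -mulr_sumr -(bigA_distr_bigA (fun i p => u p))/= prodr_const card_ord.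
have -> : (2 ^ (18 * n))%:R = 2 ^+ (16 * n) * 4 ^+ n :> R.
  rewrite natrX (_ : 4 = 2 ^+ 2); last by ring.
  by rewrite -exprM -exprD -mulnDl.
by rewrite ler_wpM2l ?exprn_ge0// lerXn2r ?nnegrE// sumr_ge0.
Qed.
End lattice_net.

(** * From the net to the l2 operator norm *)

Section bilinear.
Context (R : realType) (n : nat) (a : 'I_n -> 'I_n -> R).
Implicit Types x y : 'I_n -> R.

Definition bilinear_form y x := \sum_i \sum_j a i j * y i * x j.

Lemma bilinear_formBr y x x' :
  bilinear_form y (fun i => x i - x' i) = bilinear_form y x - bilinear_form y x'.
Proof.
rewrite /bilinear_form -sumrB; apply: eq_bigr => i _.
by rewrite -sumrB; apply: eq_bigr => j _; rewrite mulrBr.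
Qed.

Lemma bilinear_formBl y y' x :
  bilinear_form (fun i => y i - y' i) x = bilinear_form y x - bilinear_form y' x.
Proof.
rewrite /bilinear_form -sumrB; apply: eq_bigr => i _.
by rewrite -sumrB; apply: eq_bigr => j _; rewrite mulrBr mulrBl.
Qed.

Lemma bilinear_formZ c c' y x :
  bilinear_form (fun i => c * y i) (fun i => c' * x i) = c * c' * bilinear_form y x.
Proof.
rewrite /bilinear_form mulr_sumr; apply: eq_bigr => i _.
by rewrite mulr_sumr; apply: eq_bigr => j _; ring.
Qed.

Lemma ball_coord x i : \sum_j x j ^+ 2 <= 1 -> `|x i| <= 1.
Proof.
move=> x1; rewrite -(@expr_le1 _ 2)// real_normK ?num_real//.
by apply: le_trans x1; rewrite (bigD1 i)//= lerDl sumr_ge0// => j _; exact: sqr_ge0.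
Qed.

(** The supremum [s] over the two balls is finite and satisfies [s <= M + s / 2]. *)
Lemma bilinear_form_net (M : R) : (0 < n)%N ->
  (forall f g, f \in lattice_net n -> g \in lattice_net n ->
     bilinear_form (net_point R g) (net_point R f) <= M) ->
  forall x y, \sum_i x i ^+ 2 <= 1 -> \sum_i y i ^+ 2 <= 1 ->
  bilinear_form y x <= 2 * M.
Proof.
move=> n0 netM.
pose E := [set r : R | exists x y, [/\ \sum_i x i ^+ 2 <= 1,
  \sum_i y i ^+ 2 <= 1 & r = bilinear_form y x]].
pose s := sup E.
have ubE : has_ubound E.
  exists (\sum_i \sum_j `|a i j|) => _ [x [y [x1 y1 ->]]].
  apply: ler_sum => i _; apply: ler_sum => j _.
  apply: le_trans (ler_norm _) _; rewrite !normrM -mulrA ler_piMr//.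
  by rewrite mulr_ile1// ball_coord.
have Es x y : \sum_i x i ^+ 2 <= 1 -> \sum_i y i ^+ 2 <= 1 -> bilinear_form y x <= s.
  by move=> x1 y1; apply: ub_le_sup => //; exists x, y.
(* An error of norm at most [1/4] in either argument costs at most [s/4]. *)
have scale4 x : \sum_i x i ^+ 2 <= 16^-1 -> \sum_i (4 * x i) ^+ 2 <= 1.
  by move=> h; under eq_bigr do rewrite exprMn; rewrite -mulr_sumr; lra.
have sM : s <= M + s / 2.
  apply: ge_sup.
    exists (bilinear_form (fun=> 0) (fun=> 0)), (fun=> 0), (fun=> 0).
    by split => //; rewrite big1// => i _; rewrite expr0n.
  move=> _ [x [y [x1 y1 ->]]].
  have [f fn xf] := net_approx n0 x1; have [g gn yg] := net_approx n0 y1.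
  have f1 := net_point_ball R n0 fn; have g1 := net_point_ball R n0 gn.
  have e1 := Es _ _ (scale4 _ xf) y1.
  have e2 := Es _ _ f1 (scale4 _ yg).
  rewrite -[X in bilinear_form X _](_ : (fun i => 1 * y i) = y) in e1; last first.
    by apply/funext => i; rewrite mul1r.
  rewrite bilinear_formZ bilinear_formBr in e1.
  rewrite -[X in bilinear_form _ X](_ : (fun i => 1 * net_point R f i) = net_point R f)
    in e2; last by apply/funext => i; rewrite mul1r.
  rewrite bilinear_formZ bilinear_formBl in e2.
  have := netM _ _ fn gn; lra.
by move=> x y x1 y1; have := Es _ _ x1 y1; lra.
Qed.

(** Duality: test the form on normalized [x] and normalized [Ax], the cases where either vanishes
    being set apart. *)
Lemma bilinear_form_l2 (M : R) :
  (forall x y, \sum_i x i ^+ 2 <= 1 -> \sum_i y i ^+ 2 <= 1 -> bilinear_form y x <= M) ->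
  forall x, \sum_i (\sum_j a i j * x j) ^+ 2 <= M ^+ 2 * \sum_j x j ^+ 2.
Proof.
move=> aM x; set Ax := fun i => \sum_j a i j * x j.
have M0 : 0 <= M.
  have := aM (fun=> 0) (fun=> 0); rewrite /bilinear_form !big1 => [h||i _].
  - exact: h.
  - by move=> i _; rewrite big1// => j _; rewrite mulr0.
  - by rewrite expr0n.
have sq0 (z : 'I_n -> R) : 0 <= \sum_i z i ^+ 2 by apply: sumr_ge0 => i _; exact: sqr_ge0.
have unit (z : 'I_n -> R) : 0 < \sum_i z i ^+ 2 ->
    \sum_i ((Num.sqrt (\sum_i z i ^+ 2))^-1 * z i) ^+ 2 <= 1.
  move=> z0; under eq_bigr do rewrite exprMn exprVn sqr_sqrtr//.
  by rewrite -mulr_sumr mulVf// gt_eqF.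
have [Ax0|Ax0] := eqVneq (\sum_i Ax i ^+ 2) 0.
  by rewrite [leLHS]Ax0 mulr_ge0 ?sqr_ge0.
have {}Ax0 : 0 < \sum_i Ax i ^+ 2 by rewrite lt_neqAle eq_sym Ax0 sq0.
have [x0|x0] := eqVneq (\sum_i x i ^+ 2) 0.
  have xi0 i : x i = 0.
    move/eqP: x0; rewrite psumr_eq0; last by move=> j _; exact: sqr_ge0.
    by move=> /allP/(_ i (mem_index_enum _)); rewrite sqrf_eq0 => /eqP.
  suff : \sum_i Ax i ^+ 2 = 0 by move=> h; rewrite h ltxx in Ax0.
  by apply: big1 => i _; rewrite /Ax big1 ?expr0n// => j _; rewrite xi0 mulr0.
have {}x0 : 0 < \sum_i x i ^+ 2 by rewrite lt_neqAle eq_sym x0 sq0.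
have := aM _ _ (unit _ x0) (unit _ Ax0); rewrite bilinear_formZ.
have -> : bilinear_form Ax x = \sum_i Ax i ^+ 2.
  apply: eq_bigr => i _; rewrite expr2 {3}/Ax mulr_sumr.
  by apply: eq_bigr => j _; ring.
set X := Num.sqrt (\sum_i x i ^+ 2); set Y := Num.sqrt (\sum_i Ax i ^+ 2).
have X0 : 0 < X by rewrite sqrtr_gt0.
have Y0 : 0 < Y by rewrite sqrtr_gt0.
have Y2 : \sum_i Ax i ^+ 2 = Y ^+ 2 by rewrite sqr_sqrtr.
have X2 : \sum_i x i ^+ 2 = X ^+ 2 by rewrite sqr_sqrtr.
rewrite Y2 X2 -exprMn => h.
rewrite ler_sqr ?nnegrE ?(ltW Y0) ?mulr_ge0 ?(ltW X0)//.
rewrite -ler_pdivrMr//; apply: le_trans h.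
by rewrite le_eqVlt; apply/orP; left; apply/eqP; field; rewrite !gt_eqF.
Qed.

End bilinear.

(** * Measurability of the operator norm *)

Section opnorm_measurable.
Context (R : realType).

Lemma lr_norm_mono (n : nat) (r : \bar R) (c : R) (x y : 'cV[R]_n) :
  (0 < r)%E -> 0 <= c -> (forall i, c * `|x i 0| <= `|y i 0|) ->
  c * lr_norm r x <= lr_norm r y.
Proof.
move=> r0 c0 xy; case: r r0 => [p||]//.
  rewrite lte_fin => p0; have := @ge0_ler_powR R p^-1.
  rewrite invr_ge0 (ltW p0) => /(_ isT ((c * lr_norm p%:E x) `^ p)
    (\sum_(i < n) `|y i 0| `^ p)).
  rewrite !nnegrE powR_ge0 sumr_ge0; last by move=> i _; exact: powR_ge0.
  rewrite -powRrM mulfV ?gt_eqF// powRr1 ?mulr_ge0 ?lr_norm_ge0//; apply => //.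
  rewrite powRM ?lr_norm_ge0// lr_norm_powR// mulr_sumr; apply: ler_sum => i _.
  by rewrite -powRM// ge0_ler_powR ?(ltW p0) ?nnegrE ?mulr_ge0.
have [->|cn0] := eqVneq c 0; first by rewrite mul0r lr_norm_ge0.
have {}c0 : 0 < c by rewrite lt_neqAle eq_sym cn0.
move=> _; rewrite -ler_pdivlMl//; apply: bigmax_le => [|i _].
  by rewrite mulr_ge0 ?invr_ge0 ?(ltW c0)// lr_norm_ge0.
rewrite ler_pdivlMl//; apply: le_trans (xy i) _.
exact: (le_bigmax _ (fun i => `|y i 0|)).
Qed.

Lemma lr_norm0 (n : nat) (r : \bar R) : (0 < r)%E -> lr_norm r (0 : 'cV[R]_n) = 0.
Proof.
move=> r0; apply/eqP; rewrite eq_le lr_norm_ge0 andbT.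
rewrite -[leRHS](mul0r (lr_norm r (0 : 'cV[R]_n))).
(* The norm of 0 is at least twice itself, hence not positive. *)
have := @lr_norm_mono n r 2 0 0 r0 (ler0n _ _).
rewrite mul0r => h; have := h _; have := lr_norm_ge0 r (0 : 'cV[R]_n).
have E i : 2 * `|(0 : 'cV[R]_n) i 0| <= `|(0 : 'cV[R]_n) i 0|.
  by rewrite mxE normr0 mulr0.
by move=> ? /(_ E); lra.
Qed.

(** This makes the [sup] in [lr_opnorm] a true supremum rather than a default value. *)
Lemma has_ubound_opnorm (m n : nat) (r : \bar R) (A : 'M[R]_(m, n)) :
  (0 < m)%N -> (0 < r)%E ->
  has_ubound [set lr_norm r (A *m x) | x in [set x : 'cV[R]_n | lr_norm r x <= 1]].
Proof.
move=> m0 r0; exists (m%:R `^ (recip r - recip +oo%E) * \sum_i \sum_j `|A i j|).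
move=> _ [x x1 <-]; have := @lr_norm_power_mean R m r +oo%E (A *m x) m0 r0 (leey _).
move=> /le_trans; apply; rewrite ler_wpM2l ?powR_ge0//.
apply: bigmax_le => [|i _].
  by apply: sumr_ge0 => i _; apply: sumr_ge0.
rewrite (bigD1 i)//= ler_wpDr//.
  by apply: sumr_ge0 => k _; apply: sumr_ge0.
rewrite mxE; apply: le_trans (ler_norm_sum _ _ _) _; apply: ler_sum => j _.
rewrite normrM ler_piMr//; apply: le_trans x1; exact: lr_norm_coord.
Qed.

(* Rounding towards zero, which preserves the unit ball of every [lr_norm]. *)
Lemma rat_approx (x e : R) : 0 < e ->
  exists q : rat, `|ratr q : R| <= `|x| /\ `|x - ratr q| <= e.
Proof.
move=> e0; pose M := (Num.truncn e^-1).+1.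
have M0 : 0 < M%:R :> R by rewrite ltr0n.
have eM : M%:R^-1 <= e.
  by rewrite -[leRHS]invrK lef_pV2 ?posrE ?invr_gt0// ltW// truncnS_gt.
pose k := Num.truncn (M%:R * `|x|).
have /andP[k1 k2] : k%:R <= M%:R * `|x| < k.+1%:R.
  by apply: truncn_itv; rewrite mulr_ge0.
exists ((-1) ^+ (x < 0)%R * (k%:R / M%:R)).
rewrite rmorphM/= rmorphXn rmorphN1 fmorph_div/= !rmorph_nat.
rewrite normrM normrX normrN1 expr1n mul1r ger0_norm ?divr_ge0//; split.
  by rewrite ler_pdivrMr// mulrC.
rewrite {1}(realEsign (num_real x)) -mulrBr normrM normrX normrN1 expr1n mul1r.
apply: le_trans eM; rewrite ger0_norm.
  rewrite lerBlDl -[X in _ + X]mul1r -mulrDl ler_pdivlMr// mulrC natr1.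
  exact: ltW.
by rewrite subr_ge0 ler_pdivrMr// mulrC.
Qed.

(** Writes the event of exceeding [t] as a countable union. A vector [x] exceeding [t] is rounded
    towards zero, staying in the ball, so finely that every coordinate of [A *m x] keeps at least
    the fraction [1 - eps] of its absolute value. *)
Lemma opnorm_gt_rat (m n : nat) (r : \bar R) (A : 'M[R]_(m, n)) (t : R) :
  (0 < m)%N -> (0 < r)%E -> 0 <= t -> (t < lr_opnorm r A) <->
  exists q : 'cV[rat]_n, lr_norm r (map_mx ratr q : 'cV[R]_n) <= 1 /\
    t < lr_norm r (A *m map_mx ratr q).
Proof.
move=> m0 r0 t0; have ubA := has_ubound_opnorm A m0 r0; split; last first.
  move=> [q [q1 tq]]; apply: lt_le_trans tq _; apply: ub_le_sup => //.
  by exists (map_mx ratr q).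
move=> /sup_gt; case=> [|_ [x x1 <-] tx].
  by exists (lr_norm r (A *m 0)), 0 => //=; rewrite lr_norm0.
set v := A *m x in tx.
have v0 : 0 < lr_norm r v by exact: le_lt_trans tx.
(* Chosen so that [(1 - eps) * lr_norm r v] is the midpoint of [t] and [lr_norm r v]. *)
pose eps := (1 - t / lr_norm r v) / 2.
have eps0 : 0 < eps by rewrite divr_gt0// subr_gt0 ltr_pdivrMr// mul1r.
have [e e0 He] : exists2 e : R, 0 < e & forall i, v i 0 != 0 ->
    e * (\sum_j `|A i j|) <= eps * `|v i 0|.
  (* The smallest nonzero coordinate (capped at 1) turns a uniform error into a relative one; zero
     coordinates need no control. *)
  pose del := \big[Num.min/1]_(i | v i 0 != 0) `|v i 0|.
  have del0 : 0 < del by apply/bigmin_gtP; split=> // i; rewrite normr_gt0.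
  pose S := \sum_i \sum_j `|A i j|.
  have S0 : 0 <= S by apply: sumr_ge0 => i _; apply: sumr_ge0.
  exists (eps * del / (S + 1)).
    by apply: divr_gt0; [exact: mulr_gt0|exact: ltr_wpDl].
  move=> i vi; apply: (@le_trans _ _ (eps * del)).
    rewrite mulrAC ler_pdivrMr; last exact: ltr_wpDl.
    rewrite (ler_wpM2l (ltW (mulr_gt0 eps0 del0)))//.
    apply: ler_wpDr => //; rewrite /S (bigD1 i)//= lerDl.
    by apply: sumr_ge0 => k _; apply: sumr_ge0.
  by rewrite ler_pM2l//; exact: (bigmin_le_cond 1 (fun i => `|v i 0|) vi).
pose q : 'cV[rat]_n := \col_j (projT1 (cid (rat_approx (x j 0) e0))).
have qP j : `|ratr (q j 0) : R| <= `|x j 0| /\ `|x j 0 - ratr (q j 0)| <= e.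
  by rewrite mxE; exact: (projT2 (cid (rat_approx (x j 0) e0))).
exists q; split.
  apply: le_trans x1; rewrite -[leLHS]mul1r; apply: lr_norm_mono => // i.
  by rewrite mul1r mxE; have [] := qP i.
apply: (@lt_le_trans _ _ ((1 - eps) * lr_norm r v)).
  have -> : (1 - eps) * lr_norm r v = (lr_norm r v + t) / 2.
    by rewrite /eps; field; rewrite gt_eqF.
  by rewrite ltr_pdivlMr//; lra.
have eps1 : 0 <= 1 - eps.
  have : 0 <= t / lr_norm r v by rewrite divr_ge0// ltW.
  by rewrite /eps; lra.
apply: lr_norm_mono => // i.
have [->|vi] := eqVneq (v i 0) 0; first by rewrite normr0 mulr0.
have h : `|v i 0 - (A *m map_mx ratr q) i 0| <= eps * `|v i 0|.
  apply: le_trans (He i vi); rewrite /v !mxE -sumrB.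
  apply: le_trans (ler_norm_sum _ _ _) _; rewrite mulr_sumr; apply: ler_sum => j _.
  rewrite -mulrBr normrM mulrC ler_wpM2r// mxE.
  by have [_] := qP j.
have := ler_normD ((A *m map_mx ratr q) i 0) (v i 0 - (A *m map_mx ratr q) i 0).
rewrite addrC subrK; lra.
Qed.

Lemma measurable_lr_norm (d : measure_display) (T : measurableType d) (n : nat)
    (r : \bar R) (f : T -> 'cV[R]_n) :
  (forall i, measurable_fun setT (fun w => f w i 0)) ->
  measurable_fun setT (fun w => lr_norm r (f w)).
Proof.
move=> mf; case: r => [p||] /=.
- apply: (measurableT_comp (measurable_powR _)).
  apply: measurable_sum => i; apply: (measurableT_comp (measurable_powR _)).
  exact: measurableT_comp.
- elim: (index_enum _) => [|i s IH].
    by under eq_fun do rewrite big_nil; exact: measurable_cst.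
  under eq_fun do rewrite big_cons.
  by apply: measurable_maxr => //; exact: measurableT_comp.
- exact: measurable_cst.
Qed.

Lemma measurable_opnorm_gt (d : measure_display) (T : measurableType d) (m n : nat)
    (r : \bar R) (A : T -> 'M[R]_(m, n)) (t : R) :
  (0 < m)%N -> (0 < r)%E -> 0 <= t ->
  (forall i j, measurable_fun setT (fun w => A w i j)) ->
  measurable [set w | t < lr_opnorm r (A w)].
Proof.
move=> m0 r0 t0 mA.
have -> : [set w | t < lr_opnorm r (A w)] =
    \bigcup_(q in [set q : 'cV[rat]_n | lr_norm r (map_mx ratr q : 'cV[R]_n) <= 1])
      [set w | t < lr_norm r (A w *m map_mx ratr q)].
  apply/seteqP; split=> w /=.
    by move=> /(opnorm_gt_rat _ m0 r0 t0)[q [q1 tq]]; exists q.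
  by move=> [q q1 tq]; apply/(opnorm_gt_rat _ m0 r0 t0); exists q.
rewrite bigcup_mkcond; apply: countable_bigcupT_measurable => [|q].
  exact: countableP.
case: ifP => // _.
have mq : measurable_fun setT (fun w => lr_norm r (A w *m map_mx ratr q)).
  apply: measurable_lr_norm => i; under eq_fun do rewrite mxE.
  apply: measurable_sum => j; apply: measurable_funM => //.
have := mq measurableT _ (measurable_itv `]t, +oo[); rewrite setTI.
by congr measurable; apply/seteqP; split => w /=; rewrite in_itv/= andbT.
Qed.

End opnorm_measurable.

(** * The tail of the operator norm *)

Lemma sumr_measure_bigsetU (d : measure_display) (T : measurableType d) (R : realType)
    (mu : {measure set T -> \bar R}) (I : Type) (s : seq I) (F : I -> set T) :
  (forall i, measurable (F i)) ->
  (mu (\big[setU/set0]_(i <- s) F i) <= \sum_(i <- s) mu (F i))%E.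
Proof.
move=> mF; elim: s => [|i s IH]; first by rewrite !big_nil measure0.
rewrite !big_cons; apply: le_trans (measureU2 _ _ _) _ => //.
  exact: bigsetU_measurable.
by rewrite leeD2l.
Qed.

(** For [r >= 2] the power of [n] is lost in comparing the norms of the input, for [r < 2] those of
    the output; the other comparison is monotonicity in the exponent. *)
Lemma opnorm_le_l2 (R : realType) (n : nat) (A : 'M[R]_n) (s : R) (r : \bar R) :
  (0 < n)%N -> (1%:E <= r)%E -> 0 <= s ->
  (forall x, lr_norm 2%:E (A *m x) <= s * lr_norm 2%:E x) ->
  lr_opnorm r A <= n%:R `^ `|recip r - 2^-1| * s.
Proof.
move=> n0 r1 s0 As; have r0 : (0 < r)%E by exact: lt_le_trans r1.
apply: ge_sup.
  exists (lr_norm r (A *m 0)), 0 => //=; by rewrite lr_norm0.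
move=> _ [x /= x1 <-]; rewrite mulrC.
have [r2|r2] := leP 2%:E r.
  apply: le_trans (lr_norm_anti _ _ r2) _; first by rewrite lte_fin.
  apply: le_trans (As x) _; rewrite ler_wpM2l//.
  apply: le_trans (lr_norm_power_mean x n0 _ r2) _; first by rewrite lte_fin.
  rewrite -[leRHS]mulr1 ler_pM ?powR_ge0 ?lr_norm_ge0//.
  rewrite ler_powR ?ler1n// -normrN opprB ler_norm//.
apply: le_trans (lr_norm_power_mean _ n0 r0 (ltW r2)) _.
rewrite [leRHS]mulrC ler_pM ?powR_ge0 ?lr_norm_ge0//.
  by rewrite ler_powR ?ler1n// ler_norm.
apply: le_trans (As x) _; rewrite -[leRHS]mulr1 ler_wpM2l//.
exact: le_trans (lr_norm_anti _ r0 (ltW r2)) x1.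
Qed.

Lemma lr_opnorm_ge0 (R : realType) (m n : nat) (r : \bar R) (A : 'M[R]_(m, n)) :
  (0 < m)%N -> (0 < r)%E -> 0 <= lr_opnorm r A.
Proof.
move=> m0 r0; apply: ub_le_sup; first exact: has_ubound_opnorm.
by exists 0; rewrite /= ?mulmx0 lr_norm0.
Qed.

(** * Union bound over the net and tail of the masked Gram matrix *)

Section masked_gram.
Context (d : measure_display) (T : measurableType d) (R : realType)
  (P : probability T R) (N n : nat) (Z : 'I_N -> 'I_n -> {RV P >-> R}) (kappa : R).
Hypothesis n0 : (0 < n)%N.
Hypothesis nN : (n <= N)%N.
Hypothesis indepZ : mutually_independent (fun ki : 'I_N * 'I_n => Z ki.1 ki.2).
Hypothesis kappa0 : 0 < kappa.
Hypothesis mgfZ : forall k i t,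
  (\int[P]_w (expR (t * Z k i w))%:E <= (expR (3 * (t * kappa) ^+ 2))%:E)%E.
Variables (theta : R) (e : rel 'I_n).
Hypothesis eirr : irreflexive e.

Let G i j : R := (e i j)%:R.
Let A w := masked_mx theta
  (gram_mx (sample_mx (fun k i => (Z k i : T -> R)) w)) (adjacency_mx R e).

Let Q (f g : {ffun 'I_n -> bool * 'I_(16 * n).+1}) w := \sum_k \sum_i \sum_j
  G i j * net_point R g i * net_point R f j * (Z k i w * Z k j w).

Let bad (tau : R) :=
  \big[setU/set0]_(fg <- enum (finset.setX (lattice_net n) (lattice_net n)))
  [set w | tau <= Q fg.1 fg.2 w].

Let measurable_bad1 tau fg : measurable [set w | tau <= Q fg.1 fg.2 w].
Proof.
have mQ : measurable_fun setT (Q fg.1 fg.2).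
  apply: measurable_sum => k; apply: measurable_sum => i; apply: measurable_sum => j.
  by apply: measurable_funM => //; exact: measurable_funM.
have := mQ measurableT _ (measurable_itv `[tau, +oo[); rewrite setTI.
by congr measurable; apply/seteqP; split => w /=; rewrite in_itv/= andbT.
Qed.

Let N0 : 0 < N%:R :> R.
Proof. by rewrite ltr0n (leq_trans n0). Qed.

Lemma bad_event (D : R) :
  (P (bad (D * Num.sqrt (n%:R * N%:R))%R) <=
   (expR (- (n%:R * (D / (40 * kappa ^+ 2) - 37))))%:E)%E.
Proof.
have nR : 0 < n%:R :> R by rewrite ltr0n.
have k40 : 0 < 40 * kappa ^+ 2 by rewrite mulr_gt0// exprn_gt0.
(* With this choice the moment bound contributes exactly [n] to the exponent, and [n <= N] makes
   [lam] admissible. *)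
pose lam := Num.sqrt (n%:R / N%:R) / (40 * kappa ^+ 2).
have lam0 : 0 < lam by rewrite divr_gt0// sqrtr_gt0 divr_gt0.
have lamE : (40 * kappa ^+ 2 * lam) ^+ 2 = n%:R / N%:R.
  by rewrite /lam mulrC divfK ?gt_eqF// sqr_sqrtr// divr_ge0.
have lam1 : (40 * kappa ^+ 2 * lam) ^+ 2 <= 1.
  by rewrite lamE ler_pdivrMr// mul1r ler_nat.
apply: le_trans (sumr_measure_bigsetU _ _ (measurable_bad1 _)) _.
set tau := D * _.
have ltau : lam * tau = D * n%:R / (40 * kappa ^+ 2).
  rewrite /lam /tau.
  have -> : D * Num.sqrt (n%:R * N%:R) = Num.sqrt (n%:R * N%:R) * D by rewrite mulrC.
  have h : Num.sqrt (n%:R / N%:R) * Num.sqrt (n%:R * N%:R) = n%:R :> R.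
    rewrite -sqrtrM ?divr_ge0// mulrACA mulVf ?gt_eqF// mulr1 -expr2 sqrtr_sqr.
    by rewrite ger0_norm.
  by rewrite mulrAC mulrA h; ring.
apply: (@le_trans _ _ (\sum_(fg <- enum (finset.setX (lattice_net n) (lattice_net n)))
    (expR (n%:R - D * n%:R / (40 * kappa ^+ 2)))%:E)%E).
  rewrite !big_enum_cond/=; apply: lee_sum => fg; rewrite andbT inE => /andP[f1 g1].
  have := @sum_chaos_tail _ _ _ P N n Z kappa indepZ kappa0 mgfZ G
    (net_point R fg.1) (net_point R fg.2) _ _ _ _ lam tau lam0 lam1.
  rewrite lamE ltau mulrCA mulfV ?gt_eqF// mulr1; apply.
  - by move=> i; rewrite /G eirr.
  - by move=> i j; rewrite /G; case: (e i j); rewrite ?normr1 ?normr0.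
  - exact: net_point_ball.
  - exact: net_point_ball.
rewrite sumEFin lee_fin big_enum/= sumr_const cardsX -[leLHS]mulr_natl.
(* The pairs of net points number at most [2 ^ (36 n)], below [expR (36 n)]; with the [n] of the
   moment bound this makes the 37. *)
apply: (@le_trans _ _ (expR (36 * n%:R) * expR (n%:R - D * n%:R / (40 * kappa ^+ 2)))).
  rewrite ler_wpM2r ?expR_ge0//.
  apply: (@le_trans _ _ (2 ^+ (36 * n))).
    rewrite -natrX ler_nat (_ : (36 * n)%N = (18 * n + 18 * n)%N); last first.
      by rewrite -mulnDl.
    by rewrite expnD leq_mul// card_lattice_net.
  rewrite -natrM -[X in expR X]mulr1 expRM_natl lerXn2r ?nnegrE ?expR_ge0//.
  by have := expR_ge1Dx (1 : R); lra.
by rewrite -expRD ler_expR le_eqVlt; apply/orP; left; apply/eqP; field; rewrite gt_eqF.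
Qed.

Lemma masked_opnorm_le (D : R) (r : \bar R) w : 0 <= D -> (1%:E <= r)%E ->
  ~ bad (D * Num.sqrt (n%:R * N%:R)) w ->
  lr_opnorm r (A w) <=
    2 * `|theta| * D * (n%:R `^ (2^-1 + `|recip r - 2^-1|) / Num.sqrt N%:R).
Proof.
move=> D0 r1 nbad; have nR : 0 < n%:R :> R by rewrite ltr0n.
set M := D * Num.sqrt (n%:R * N%:R) in nbad.
pose a i j := G i j * \sum_k Z k i w * Z k j w.
have net_le f g : f \in lattice_net n -> g \in lattice_net n ->
    bilinear_form a (net_point R g) (net_point R f) <= M.
  move=> fn gn; rewrite leNgt; apply/negP => /ltW Mle; apply: nbad.
  rewrite /bad -bigcup_seq; exists (f, g) => /=.
    by rewrite mem_enum inE fn gn.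
  apply: le_trans Mle _; rewrite /Q exchange_big /=.
  rewrite le_eqVlt; apply/orP; left; apply/eqP; apply: eq_bigr => i _.
  rewrite exchange_big/=; apply: eq_bigr => j _.
  rewrite /a mulr_sumr !mulr_suml; apply: eq_bigr => k _; ring.
have a_l2 := bilinear_form_l2 (bilinear_form_net n0 net_le).
(* The factor 2 is the loss of the net; [sqrt (n N) / N] then becomes [sqrt n / sqrt N]. *)
pose s := `|theta| / N%:R * (2 * M).
have M0 : 0 <= M by rewrite mulr_ge0// sqrtr_ge0.
have s0 : 0 <= s by rewrite mulr_ge0 ?divr_ge0 ?mulr_ge0// ltW.
have As x : lr_norm 2%:E (A w *m x) <= s * lr_norm 2%:E x.
  rewrite -ler_sqr ?nnegrE ?mulr_ge0 ?lr_norm_ge0// exprMn !lr_norm2_sqr.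
  have -> : \sum_i (A w *m x) i 0 ^+ 2 =
      (theta / N%:R) ^+ 2 * \sum_i (\sum_j a i j * x j 0) ^+ 2.
    rewrite mulr_sumr; apply: eq_bigr => i _; rewrite -exprMn; congr (_ ^+ 2).
    rewrite mxE mulr_sumr; apply: eq_bigr => j _; rewrite !mxE /a.
    under eq_bigr do rewrite !mxE.
    by rewrite /G; ring.
  apply: le_trans (ler_wpM2l (sqr_ge0 _) (a_l2 (fun j => x j 0))) _.
  rewrite mulrA ler_wpM2r//; first by apply: sumr_ge0 => i _; exact: sqr_ge0.
  by rewrite /s !exprMn real_normK ?num_real.
apply: le_trans (opnorm_le_l2 n0 r1 s0 As) _.
have sE : s = 2 * `|theta| * D * (n%:R `^ 2^-1 / Num.sqrt N%:R).
  rewrite /s /M powR12_sqrt ?(ltW nR)// sqrtrM ?(ltW nR)//.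
  have N2 : N%:R = Num.sqrt N%:R ^+ 2 :> R by rewrite sqr_sqrtr// ltW.
  by rewrite {1}N2; field; rewrite gt_eqF// sqrtr_gt0.
rewrite sE powRD ?(gt_eqF nR) ?implybT//.
by rewrite le_eqVlt; apply/orP; left; apply/eqP; ring.
Qed.

Lemma masked_opnorm_tail (D : R) (r : \bar R) : 0 <= D -> (1%:E <= r)%E ->
  (P [set w | (2 * `|theta| * D *
       (n%:R `^ (2^-1 + `|recip r - 2^-1|) / Num.sqrt N%:R) < `|lr_opnorm r (A w)|)%R]
   <= (expR (- (n%:R * (D / (40 * kappa ^+ 2) - 37))))%:E)%E.
Proof.
move=> D0 r1; have r0 : (0 < r)%E by exact: lt_le_trans r1.
apply: le_trans (bad_event D).
have mA w i j : A w i j =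
    theta * (N%:R^-1 * \sum_k Z k i w * Z k j w) * (e i j)%:R.
  by rewrite !mxE; under eq_bigr do rewrite !mxE.
set b := 2 * _ * _ * _.
have -> : [set w | b < `|lr_opnorm r (A w)|] = [set w | b < lr_opnorm r (A w)].
  by apply/seteqP; split=> w /=; rewrite ger0_norm ?lr_opnorm_ge0.
(* Monotonicity of [P] requires both events to be measurable, whence the rational description of the
   operator norm. *)
apply: le_measure; rewrite ?inE.
- apply: measurable_opnorm_gt => //.
    by rewrite !mulr_ge0 ?invr_ge0 ?powR_ge0 ?sqrtr_ge0.
  move=> i j; under eq_fun do rewrite mA.
  apply: measurable_funM => //; apply: measurable_funM => //.
  apply: measurable_funM => //; apply: measurable_sum => k.
  exact: measurable_funM.
- exact: bigsetU_measurable.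
- move=> w /= h.
  apply: contrapT => /(masked_opnorm_le D0 r1); rewrite leNgt => /negP; exact.
Qed.

End masked_gram.

(** As [n >= 1], the exponent is at most [- |ln eps|], hence at most [ln eps] whatever its sign. *)
Lemma expR_neg_ln_le (R : realType) (eps : R) (n : nat) :
  0 < eps -> (0 < n)%N -> expR (- (n%:R * `|ln eps|)) <= eps.
Proof.
move=> e0 n0; rewrite -[leRHS](lnK e0) ler_expR lerNl.
apply: (@le_trans _ _ `|ln eps|); first by rewrite -normrN ler_norm.
by rewrite ler_peMl// ler1n.
Qed.

Theorem lemma4p1 (R : realType)
    (d : nat -> measure_display) (T : forall n, measurableType (d n))
    (P : forall n, probability (T n) R)
    (N : nat -> nat)
    (Z : forall n, 'I_(N n) -> 'I_n -> {RV (P n) >-> R})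
    (e : forall n, rel 'I_n)
    (theta K : R)
    (hN : forall n, (n <= N n)%N)
    (Zindep : forall n, mutually_independent
       (fun ki : 'I_(N n) * 'I_n => Z n ki.1 ki.2))
    (Zmean : forall n k i, ('E_(P n)[Z n k i] = 0)%E)
    (Zvar : forall n k i, ('V_(P n)[Z n k i] = 1)%E)
    (Zsubg : forall n k i, (psi2_norm (P n) (Z n k i) <= K%:E)%E)
    (esym : forall n, symmetric (e n))
    (eirr : forall n, irreflexive (e n)) :
  let A := fun n (w : T n) =>
    masked_mx theta
      (gram_mx (sample_mx (fun k i => (Z n k i : T n -> R)) w))
      (adjacency_mx R (e n)) in
  (forall r : \bar R, (2%:E <= r)%E ->
     bigO_P P (fun n w => lr_opnorm r (A n w))
       (fun n => n%:R `^ (1 - recip r) / Num.sqrt (N n)%:R)) /\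
  (forall r : \bar R, (1%:E <= r)%E -> (r < 2%:E)%E ->
     bigO_P P (fun n w => lr_opnorm r (A n w))
       (fun n => n%:R `^ recip r / Num.sqrt (N n)%:R)).
Proof.
move=> A.
(* One exponent serves both ranges: it equals [1 - 1/r] for [r >= 2] and [1/r] for [r < 2]. *)
suff main r : (1%:E <= r)%E -> bigO_P P (fun n w => lr_opnorm r (A n w))
    (fun n => n%:R `^ (2^-1 + `|recip r - 2^-1|) / Num.sqrt (N n)%:R).
  split=> r.
    move=> r2; have := main r (le_trans _ r2); rewrite lee_fin ler1n => /(_ isT).
    suff -> : 2^-1 + `|recip r - 2^-1| = 1 - recip r by [].
    case: r r2 => [p||]// r2 /=.
      rewrite lee_fin in r2; rewrite ler0_norm; first by lra.
      by rewrite subr_le0 lef_pV2 ?posrE// (lt_le_trans _ r2).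
    by rewrite sub0r normrN ger0_norm; lra.
  move=> r1 r2; have := main r r1.
  suff -> : 2^-1 + `|recip r - 2^-1| = recip r by [].
  case: r r1 r2 => [p||]//; rewrite lee_fin lte_fin => p1 p2 /=.
  rewrite ger0_norm; first by lra.
  by rewrite subr_ge0 lef_pV2 ?posrE ?(ltW p2)// (lt_le_trans _ p1).
move=> r1 eps eps0; pose kappa := `|K| + 1.
have k0 : 0 < kappa by rewrite ltr_wpDl.
have k40 : 0 < 40 * kappa ^+ 2 by rewrite mulr_gt0// exprn_gt0.
(* Solves [D / (40 * kappa ^+ 2) - 37 = |ln eps|], so the tail is at most [expR (- n |ln eps|)]. *)
pose D := 40 * kappa ^+ 2 * (37 + `|ln eps|).
exists (2 * `|theta| * D); exists 1%N => // n /= n0.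
have mgf k i t : (\int[P n]_w (expR (t * Z n k i w))%:E <=
    (expR (3 * (t * kappa) ^+ 2))%:E)%E.
  have E2 := psi2_norm_expR (@measurable_funPT _ _ _ _ (Z n k i)) (Zsubg n k i).
  apply: subgaussian_mgf => //.
  by have := Zmean n k i; rewrite unlock.
have D0 : 0 <= D by rewrite mulr_ge0 ?(ltW k40)// addr_ge0.
apply: le_trans (masked_opnorm_tail n0 (hN n) (Zindep n) k0 mgf theta (eirr n) D0 r1) _.
rewrite lee_fin (_ : D / _ - 37 = `|ln eps|).
  exact: expR_neg_ln_le.
by rewrite /D mulrAC divff ?gt_eqF// mul1r addrC addKr.
Qed.
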